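(* Let $\mathbb{D}$ be a skew field, $d\ge 2$, and let $(V,\mathcal{P},\mathcal{B})$ be a $\mathrm{TD}(3,n)$ which lies on the hyperplanes $H_1,H_2,H_3$ of $P^d(\mathbb{D})$, where $\dim(H_1\cap H_2\cap H_3)=d-2$. Choose points $1_1\in H_1\cap V$ and $1_2\in H_2\cap V$, let $1_3$ be the point of $H_3\cap V$ on the block through $1_1$ and $1_2$, and choose homogeneous coordinates such that $H_1\cap H_2\cap H_3=\{[\boldsymbol{x},0,0] : \boldsymbol{x}\in\mathbb{D}^{d-1}\}$, $1_1=[\boldsymbol{o},0,1]$, $1_2=[\boldsymbol{o},1,1]$, $1_3=[\boldsymbol{o},1,0]$ (so that $H_1,H_2,H_3$ have the equations $x_d=0$, $x_d=x_{d+1}$, $x_{d+1}=0$, respectively). Then there exists a subgroup $G$ of $(\mathbb{D}^{d-1},+)$ of order $n$ such that $$H_1\cap V=\{[\boldsymbol{\gamma},0,1] : \boldsymbol{\gamma}\in G\},\quad H_2\cap V=\{[\boldsymbol{\gamma},1,1] : \boldsymbol{\gamma}\in G\},\quad H_3\cap V=\{[-\boldsymbol{\gamma},1,0] : \boldsymbol{\gamma}\in G\}. \qquad ( * )$$ The group $G$ depends only on the choice of coordinates. For any two such choices (of $1_1$, $1_2$ and coordinates), the two groups $G_1$ and $G_2$ so obtained satisfy $G_1=TG_2a$ for some $a\in\mathbb{D}^*$ and $T\in GL_{d-1}(\mathbb{D})$. Conversely, given any subgroup $G$ of $(\mathbb{D}^{d-1},+)$ of order $n\ge 3$, $( * )$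 gives an embedding of a $\mathrm{TD}(3,n)$ on the hyperplanes $H_1,H_2,H_3$ with equations $x_d=0$, $x_d=x_{d+1}$, $x_{d+1}=0$, respectively; that is, the three sets on the right-hand sides of $( * )$ are the parts, and the collinear triples consisting of one point from each of these three sets are the blocks, of a $\mathrm{TD}(3,n)$ lying on $H_1,H_2,H_3$.
   Context: A transversal design $\mathrm{TD}(k,n)$, with $n\ge 3$, $k\ge 3$, is a triple $(V,\mathcal{P},\mathcal{B})$ where $V$ is a set of size $kn$, $\mathcal{P}$ is a partition of $V$ into $k$ subsets of size $n$ (called parts), and $\mathcal{B}$ is a set of $k$-subsets of $V$ (called blocks), such that any two distinct elements of $V$ are contained in either a unique part or a unique block, but not both. For a skew field $\mathbb{D}$, $\mathbb{D}^*=\mathbb{D}\setminus\{0\}$, and $\mathbb{D}^{m}$ is regarded as a right vector space: $(x_1,\dots,x_m)\alpha=(x_1\alpha,\dots,x_m\alpha)$. Matrices in $GL_m(\mathbb{D})$ act on the left of column vectors. $P^d(\mathbb{D})$ is the $d$-dimensional projective space of one-dimensional subspaces of the right vector space $\mathbb{D}^{d+1}$; $[x_1,\dots,x_{d+1}]$ denotes the point with those homogeneous coordinates (with respect to some basis of $\mathbb{D}^{d+1}$; a choice of homogeneous coordinates means a choice of basis). Here $[\boldsymbol{x},y,z]$ has $\boldsymbol{x}\in\mathbb{D}^{d-1}$, $y,z\in\mathbb{D}$, and $\boldsymbol{o}$ is the zero vector of $\mathbb{D}^{d-1}$. Hyperplanes are $(d-1)$-flats, with equations $\alpha_1x_1+\dots+\alpha_{d+1}x_{d+1}=0$,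 not all $\alpha_i=0$. Dimension is projective dimension. A $\mathrm{TD}(3,n)$ $(V,\mathcal{P},\mathcal{B})$ lies on (is embedded on) the hyperplanes $H_1,H_2,H_3$ of $P^d(\mathbb{D})$ if $V\subseteq P^d(\mathbb{D})$, the hyperplanes $H_1,H_2,H_3$ are distinct, $\mathcal{P}=\{V\cap H_1,V\cap H_2,V\cap H_3\}$, every block $B$ is contained in a line $\ell_B$ of $P^d(\mathbb{D})$, the lines $\ell_B$ ($B\in\mathcal{B}$) are distinct, and no $\ell_B$ is contained in any $H_i$. For $G\subseteq\mathbb{D}^{d-1}$, $TGa=\{T\boldsymbol{\gamma}a : \boldsymbol{\gamma}\in G\}$. *)

(* Defs.v *)
From mathcomp Require Import all_boot all_algebra all_classical.

Set Implicit Arguments.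
Unset Strict Implicit.
Unset Printing Implicit Defensive.

Import GRing.Theory.

Local Open Scope classical_set_scope.
Local Open Scope ring_scope.
Local Open Scope card_scope.

(* Points of a space T; parts and blocks are sets of points.  The last clause
   says that two distinct points are in exactly one part and no block, or in
   exactly one block and no part. *)
Definition transversal_design (T : Type) (k n : nat)
    (V : set T) (P B : set (set T)) : Prop :=
  [/\ (3 <= n)%N /\ (3 <= k)%N,
      V #= `I_(k * n),
      [/\ partition P id V, P #= `I_k & forall X, P X -> X #= `I_n],
      forall b, B b -> b `<=` V /\ b #= `I_k
    & forall x y, V x -> V y -> x <> y ->
        ((exists! X, [/\ P X, X x & X y]) /\ ~ (exists b, [/\ B b, b x & b y]))
        \/
        ((exists! b, [/\ B b, b x & b y]) /\ ~ (exists X, [/\ P X, X x & X y]))].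

Section Projective.

(* D is a general unit ring: no definition needs it to be a skew field. *)
Variable D : unitRingType.

(* The right scalar multiplication.  The library's [a *: v] is the left one,
   with respect to which the maps v |-> A *m v are not linear. *)
Definition rscale m (v : 'cV[D]_m) (a : D) : 'cV[D]_m := v *m a%:M.

Definition columns_free m k (A : 'M[D]_(m, k)) : Prop :=
  forall c : 'cV[D]_k, A *m c = 0 -> c = 0.

Definition columns_basis m (U : 'M[D]_m) : Prop :=
  columns_free U /\ forall v : 'cV[D]_m, exists c, v = U *m c.

Definition general_linear m : set 'M[D]_m :=
  [set T | exists S : 'M[D]_m, T *m S = 1%:M /\ S *m T = 1%:M].

Definition right_span m (v : 'cV[D]_m) : set 'cV[D]_m :=
  [set rscale v a | a in [set: D]].

Variable d : nat.

(* A point is a one-dimensional subspace, as a set of vectors; this type has all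
   sets of vectors, and the points are the elements of projective_space. *)
Definition proj_point := set 'cV[D]_d.+1.

Definition projective_space : set proj_point :=
  [set right_span v | v in [set v | v != 0]].

Definition flat (r : nat) (F : set proj_point) : Prop :=
  exists A : 'M[D]_(d.+1, r.+1), columns_free A /\
    F = [set p | projective_space p /\ p `<=` [set A *m c | c in [set: 'cV_r.+1]]].

Definition line : set proj_point -> Prop := flat 1.

Definition collinear (p1 p2 p3 : proj_point) : Prop :=
  exists l, [/\ line l, l p1, l p2 & l p3].

(* Homogeneous coordinates are taken with respect to the basis formed by the
   columns of a matrix U: the vector with coordinates c is U *m c.  The locus
   of e consists of the points all of whose coordinate vectors satisfy e. *)
Definition locus (U : 'M[D]_d.+1) (e : 'cV[D]_d.+1 -> Prop) : set proj_point :=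
  [set p | projective_space p /\ forall c, p (U *m c) -> e c].

Definition hyperplane (H : set proj_point) : Prop :=
  exists2 alpha : 'rV[D]_d.+1, alpha != 0 &
    H = locus 1%:M (fun c => alpha *m c = 0).

Definition lies_on (V : set proj_point) (P B : set (set proj_point))
    (H1 H2 H3 : set proj_point) : Prop :=
  [/\ V `<=` projective_space,
      [/\ hyperplane H1, hyperplane H2 & hyperplane H3],
      [/\ H1 <> H2, H1 <> H3 & H2 <> H3],
      P = [set V `&` H1; V `&` H2; V `&` H3]
    & exists ell : set proj_point -> set proj_point,
        [/\ forall b, B b -> line (ell b) /\ b `<=` ell b,
            forall b b', B b -> B b' -> ell b = ell b' -> b = b'
          & forall b, B b ->
              [/\ ~ ell b `<=` H1, ~ ell b `<=` H2 & ~ ell b `<=` H3]]].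

(* The vector (x, y, z) with x in D^(d-1); only meaningful for d >= 1. *)
Definition xyz (x : 'cV[D]_d.-1) (y z : D) : 'cV[D]_d.+1 :=
  \col_i (if insub (i : nat) is Some j then x j 0
          else if (i : nat) == d.-1 then y else z).

Definition hpoint (U : 'M[D]_d.+1) (x : 'cV[D]_d.-1) (y z : D) : proj_point :=
  right_span (U *m xyz x y z).

(* The entries x_d and x_(d+1) have the indices d.-1 and d. *)
Definition xd_eq0 (U : 'M[D]_d.+1) : set proj_point :=
  locus U (fun c => c (inord d.-1) 0 = 0).
Definition xd_eq_xd1 (U : 'M[D]_d.+1) : set proj_point :=
  locus U (fun c => c (inord d.-1) 0 = c ord_max 0).
Definition xd1_eq0 (U : 'M[D]_d.+1) : set proj_point :=
  locus U (fun c => c ord_max 0 = 0).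

Definition third_point (V : set proj_point) (B : set (set proj_point))
    (H3 : set proj_point) (p1 p2 p3 : proj_point) : Prop :=
  (H3 `&` V) p3 /\ exists b, [/\ B b, b p1, b p2 & b p3].

Definition adapted_basis (H1 H2 H3 : set proj_point) (p1 p2 p3 : proj_point)
    (U : 'M[D]_d.+1) : Prop :=
  [/\ columns_basis U,
      H1 `&` H2 `&` H3 = [set hpoint U x 0 0 | x in [set x | x != 0]],
      p1 = hpoint U 0 0 1,
      p2 = hpoint U 0 1 1
    & p3 = hpoint U 0 1 0].

Definition admissible_choice (V : set proj_point) (B : set (set proj_point))
    (H1 H2 H3 : set proj_point) (p1 p2 p3 : proj_point)
    (U : 'M[D]_d.+1) : Prop :=
  [/\ (H1 `&` V) p1, (H2 `&` V) p2, third_point V B H3 p1 p2 p3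
    & adapted_basis H1 H2 H3 p1 p2 p3 U].

Definition additive_subgroup (n : nat) (G : set 'cV[D]_d.-1) : Prop :=
  zmod_closed (mem G) /\ G #= `I_n.

Definition part1 (U : 'M[D]_d.+1) (G : set 'cV[D]_d.-1) : set proj_point :=
  [set hpoint U g 0 1 | g in G].
Definition part2 (U : 'M[D]_d.+1) (G : set 'cV[D]_d.-1) : set proj_point :=
  [set hpoint U g 1 1 | g in G].
Definition part3 (U : 'M[D]_d.+1) (G : set 'cV[D]_d.-1) : set proj_point :=
  [set hpoint U (- g) 1 0 | g in G].

Definition coordinate_group (n : nat) (V H1 H2 H3 : set proj_point)
    (U : 'M[D]_d.+1) (G : set 'cV[D]_d.-1) : Prop :=
  additive_subgroup n G /\
  [/\ H1 `&` V = part1 U G, H2 `&` V = part2 U G & H3 `&` V = part3 U G].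

Definition collinear_triples (Q1 Q2 Q3 : set proj_point) :
    set (set proj_point) :=
  [set b | exists p1 p2 p3, [/\ Q1 p1, Q2 p2, Q3 p3, collinear p1 p2 p3
                              & b = [set p1; p2; p3]]].

End Projective.

(* Main.v *)
Require Import Defs.
From mathcomp Require Import all_boot all_algebra all_classical.

(* In the given coordinates the points [x,0,1], [y,1,1], [z,1,0] are collinear
   iff y = x + z: a linear dependency of the three vectors forces the
   coefficients a, -a, a.  Two points of the design in different parts lie on a
   block, which has a point in the third part, so the coordinate sets G1, G2 and
   -G3 of the three parts satisfy G2 - G1 <= -G3, G1 - G3 <= G2, G2 + G3 <= G1.
   As all three contain 0, they coincide and form a subgroup.  A change of
   coordinates preserving H1, H3 and the axis H1 /\ H2 /\ H3 maps [g,0,1] to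
   [T g + w,0,s] with T invertible and s <> 0; the translation by w s^-1 lies in
   the group and can be dropped.  The existence of coordinates rests on the fact
   that a free square matrix over a skew field spans, since a matrix with more
   columns than rows has a nontrivial kernel. *)

Set Implicit Arguments.
Unset Strict Implicit.
Unset Printing Implicit Defensive.

Import GRing.Theory.

Local Open Scope classical_set_scope.
Local Open Scope ring_scope.
Local Open Scope card_scope.

(** * Linear algebra over a skew field *)

Section RightScaling.
Variable D : unitRingType.
Implicit Types a b : D.

Lemma rscaleE m (v : 'cV[D]_m) a i : rscale v a i 0 = v i 0 * a.
Proof. by rewrite /rscale mxE big_ord1 !mxE eqxx mulr1n. Qed.

Lemma rscaleA m (v : 'cV[D]_m) a b : rscale (rscale v a) b = rscale v (a * b).
Proof. by apply/colP=> i; rewrite !rscaleE mulrA. Qed.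

Lemma rscale1 m (v : 'cV[D]_m) : rscale v 1 = v.
Proof. by apply/colP=> i; rewrite rscaleE mulr1. Qed.

Lemma rscaler0 m (v : 'cV[D]_m) : rscale v 0 = 0.
Proof. by apply/colP=> i; rewrite rscaleE mxE mulr0. Qed.

Lemma rscale0r m a : rscale (0 : 'cV[D]_m) a = 0.
Proof. by rewrite /rscale mul0mx. Qed.

Lemma rscaleN m (v : 'cV[D]_m) a : rscale v (- a) = - rscale v a.
Proof. by apply/colP=> i; rewrite [RHS]mxE !rscaleE mulrN. Qed.

Lemma mulmx_rscale m k (A : 'M[D]_(m, k)) v a :
  A *m rscale v a = rscale (A *m v) a.
Proof. exact: mulmxA. Qed.

Lemma right_span_id m (v : 'cV[D]_m) : right_span v v.
Proof. by exists 1 => //; rewrite rscale1. Qed.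

End RightScaling.

(** * Kernels, bases and lines over a skew field *)

Section SkewField.
Variable D : unitRingType.
Hypothesis skewD : forall x : D, x != 0 -> x \is a GRing.unit.
Implicit Types a b : D.

Lemma skew_mulf_eq0 a b : (a * b == 0) = (a == 0) || (b == 0).
Proof.
case: (eqVneq b 0) => [->|/skewD ub]; first by rewrite mulr0 eqxx orbT.
by rewrite orbF -[RHS](inj_eq (mulIr ub)) mul0r.
Qed.

Lemma rscale_eq0 m (v : 'cV[D]_m) a : rscale v a = 0 -> v = 0 \/ a = 0.
Proof.
case: (eqVneq a 0) => [->|/skewD ua]; first by right.
by move=> va0; left; rewrite -(rscale1 v) -(divrr ua) -rscaleA va0 rscale0r.
Qed.

Lemma right_span_rscale m (v : 'cV[D]_m) a :
  a != 0 -> right_span (rscale v a) = right_span v.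
Proof.
move=> /skewD ua; rewrite eqEsubset; split=> _ [b _ <-].
  by rewrite rscaleA; exists (a * b).
by exists (a^-1 * b) => //; rewrite rscaleA mulVKr.
Qed.

Lemma right_span_inj m (v w : 'cV[D]_m) : w != 0 -> right_span v = right_span w ->
  exists2 a, a != 0 & w = rscale v a.
Proof.
move=> w0 vw; have : right_span v w by rewrite vw; apply: right_span_id.
move=> [a _ wE]; exists a => //; apply: contra_neq w0 => a0.
by rewrite -wE a0 rscaler0.
Qed.

(** Gaussian elimination, by induction on the number of rows. A pivot in row 0 lets one unknown be
    solved for, which removes one row and one column; a zero row 0 is simply dropped. *)
Lemma wide_kernel m n (A : 'M[D]_(m, n)) : (m < n)%N ->
  exists2 c : 'cV_n, c != 0 & A *m c = 0.
Proof.
elim: m n A => [|m IH] [//|n] A lt_mn.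
  exists (const_mx 1); last by rewrite flatmx0.
  by apply/eqP => /colP/(_ 0); rewrite !mxE; apply/eqP/oner_neq0.
have mul0row k (C : 'M[D]_(m.+1, k)) : row 0 C = 0 -> row' 0 C = 0 -> C = 0.
  move=> C0 C'0; apply/matrixP => i j; rewrite mxE.
  case: (unliftP 0 i) => [i'|] ->.
    by move/matrixP/(_ i' j): C'0; rewrite !mxE.
  by move/matrixP/(_ 0 j): C0; rewrite !mxE.
case: (boolP [exists j, A 0 j != 0]) => [/existsP[j /skewD uA]|].
  (* The columns of [B] parametrise the kernel of row 0: the coordinates other than [j] are free,
     and coordinate [j] is solved for with the inverse of the pivot on the left. *)
  pose B : 'M[D]_(n.+1, n) := \matrix_(i, k)
    (if unlift j i is Some i' then (i' == k)%:R
     else - ((A 0 j)^-1 * A 0 (lift j k))).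
  have [c c0 Bc] := IH _ (row' 0 (A *m B)) lt_mn.
  (* The free coordinates of [B *m c] are those of [c], so [B *m c] is nonzero. *)
  have BE k : (B *m c) (lift j k) 0 = c k 0.
    rewrite mxE (bigD1 k)//= !mxE liftK eqxx mul1r big1 ?addr0// => i ik.
    by rewrite mxE liftK eq_sym (negPf ik) mul0r.
  exists (B *m c).
    by apply: contra_neq c0 => /colP Bc0; apply/colP => k; rewrite -BE Bc0 !mxE.
  rewrite mulmxA; apply: mul0row; last by rewrite -[RHS]Bc !row'Esub mul_rowsub_mx.
  rewrite row_mul; suff -> : row 0 (A *m B) = 0 by rewrite mul0mx.
  apply/rowP => k; rewrite !mxE (bigD1_ord j)//= !mxE unlift_none mulrN mulVKr//.
  rewrite (bigD1 k)//= !mxE liftK eqxx mulr1 big1 ?addr0 ?addNr// => i ik.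
  by rewrite mxE liftK (negPf ik) mulr0.
rewrite negb_exists => /forallP A0.
have [c c0 Ac] := IH _ (row' 0 A) (ltnW lt_mn).
exists c => //; apply: mul0row; last by rewrite -[RHS]Ac !row'Esub mul_rowsub_mx.
rewrite row_mul; suff -> : row 0 A = 0 by rewrite mul0mx.
by apply/rowP => k; rewrite !mxE; apply/eqP; have := A0 k; rewrite negbK.
Qed.

(** Appending [v] to [U] gives more columns than rows, hence a relation [U *m c + v t = 0]. Freeness
    of [U] excludes [t = 0], and dividing by [t] on the right expresses [v]. *)
Lemma square_free_basis m (U : 'M[D]_m) : columns_free U -> columns_basis U.
Proof.
move=> freeU; split=> // v.
have [|k k0] := @wide_kernel _ _ (row_mx U v); first by rewrite addn1.
rewrite -(vsubmxK k) mul_row_col [dsubmx k]mx11_scalar.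
set c := usubmx k; set t := dsubmx k 0 0 => Uct.
have /skewD ut : t != 0.
  apply: contra_neq k0 => t0; move: Uct; rewrite -[_ *m t%:M]/(rscale v t) t0.
  rewrite rscaler0 addr0 => /freeU c0.
  by rewrite -(vsubmxK k) [dsubmx k]mx11_scalar -/c -/t t0 c0 raddf0 col_mx0.
exists (rscale c (- t^-1)); rewrite mulmx_rscale rscaleN.
move/eqP: Uct; rewrite addr_eq0 => /eqP ->.
rewrite -[_ *m t%:M]/(rscale v t) -(rscaleN v) rscaleA -rscaleN mulNr.
by rewrite opprK divrr// rscale1.
Qed.

Lemma mulmx_cV_inj m k (A B : 'M[D]_(m, k)) :
  (forall c : 'cV_k, A *m c = B *m c) -> A = B.
Proof.
move=> AB; apply/matrixP => i j.
by have /colP/(_ i) := AB (delta_mx j 0); rewrite -!colE !mxE.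
Qed.

(** Spanning gives a right inverse column by column. It is also a left inverse, because [U] kills
    [W *m U *m c - c] and is free. *)
Lemma basis_inverse m (U : 'M[D]_m) : columns_basis U ->
  exists W : 'M[D]_m, U *m W = 1%:M /\ W *m U = 1%:M.
Proof.
move=> [freeU spanU]; have [f fE] := choice spanU.
pose W : 'M[D]_m := \matrix_(i, j) f (delta_mx j 0) i 0.
have UW : U *m W = 1%:M.
  apply/matrixP => i j; have /colP/(_ i) := fE (delta_mx j 0).
  by rewrite -col1 !mxE => ->; apply: eq_bigr => k _; rewrite col1 mxE.
exists W; split=> //; apply: mulmx_cV_inj => c.
apply/eqP; rewrite -subr_eq0; apply/eqP/freeU.
by rewrite mulmxBr !mulmxA UW mulmx1 mul1mx subrr.
Qed.

Lemma mulmx_basis_eq0 m (U : 'M[D]_m) c : columns_basis U ->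
  (U *m c == 0 :> 'cV_m) = (c == 0).
Proof.
by move=> [freeU _]; apply/eqP/eqP => [/freeU|->]; rewrite ?mulmx0.
Qed.

Variable d : nat.
Implicit Types (p : proj_point D d) (v : 'cV[D]_d.+1).

(** The vectors have coordinates in the two-dimensional space that spans the line, and a matrix with
    two rows and three columns has a kernel. *)
Lemma collinear_dependent p1 p2 p3 v1 v2 v3 :
  collinear p1 p2 p3 -> p1 v1 -> p2 v2 -> p3 v3 ->
  exists a b c, ~ [/\ a = 0, b = 0 & c = 0] /\
    rscale v1 a + rscale v2 b + rscale v3 c = 0.
Proof.
move=> [l [[A [_ ->]] [_ l1] [_ l2] [_ l3]]] /l1[c1 _ <-] /l2[c2 _ <-] /l3[c3 _ <-].
have [//|k k0 ck] := @wide_kernel _ _ (row_mx c1 (row_mx c2 c3)).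
move: k0 ck; rewrite -(vsubmxK k) -(vsubmxK (dsubmx k)).
rewrite [usubmx k]mx11_scalar [usubmx (dsubmx k)]mx11_scalar.
rewrite [dsubmx (dsubmx k)]mx11_scalar.
set a := usubmx _ _ _; set b := usubmx _ _ _; set c := dsubmx _ _ _ => k0.
rewrite !mul_row_col => ck; exists a, b, c; split=> [[a0 b0 c0]|].
  by move: k0; rewrite a0 b0 c0 !raddf0 !col_mx0 eqxx.
by rewrite -!mulmx_rscale -!mulmxDr -addrA ck mulmx0.
Qed.

Lemma spanned_line v1 v2 :
    (forall a b, rscale v1 a + rscale v2 b = 0 -> a = 0 /\ b = 0) ->
  exists2 l, line l & forall a b, rscale v1 a + rscale v2 b != 0 ->
    l (right_span (rscale v1 a + rscale v2 b)).
Proof.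
move=> free12.
have rowE (c : 'cV[D]_(1 + 1)) : row_mx v1 v2 *m c =
    rscale v1 (usubmx c 0 0) + rscale v2 (dsubmx c 0 0).
  rewrite -{1}(vsubmxK c) mul_row_col.
  by rewrite [usubmx c in LHS]mx11_scalar [dsubmx c in LHS]mx11_scalar.
eexists.
  exists (row_mx v1 v2); split; last by [].
  move=> c; rewrite [LHS]rowE => /free12[a0 b0].
  rewrite -(vsubmxK (c : 'cV_(1 + 1))) [usubmx _]mx11_scalar [dsubmx _]mx11_scalar.
  by rewrite a0 b0 !raddf0 col_mx0.
move=> a b ab0; split; first by exists (rscale v1 a + rscale v2 b).
move=> _ [t _ <-]; exists (rscale (col_mx a%:M b%:M) t) => //.
by rewrite mulmx_rscale [_ *m _]rowE col_mxKu col_mxKd !mxE.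
Qed.

End SkewField.

(** * Homogeneous coordinates *)

Section Coordinates.
Variable D : unitRingType.
Hypothesis skewD : forall x : D, x != 0 -> x \is a GRing.unit.
Variable d : nat.
Hypothesis d_gt0 : (0 < d)%N.
Implicit Types (a b y z s t : D) (x : 'cV[D]_d.-1) (c : 'cV[D]_d.+1).
Implicit Types (U M : 'M[D]_d.+1) (p : proj_point D d).

Definition xpart c : 'cV[D]_d.-1 := \col_j c (inord j) 0.

Lemma xpart_xyz x y z : xpart (xyz x y z) = x.
Proof.
apply/colP => j; rewrite !mxE inordK; last first.
  by rewrite (leq_trans (ltn_ord j))// (leq_trans (leq_pred _)).
by rewrite valK.
Qed.

Lemma xyz_yE x y z : xyz x y z (inord d.-1) 0 = y.
Proof.
by rewrite mxE inordK ?ltnS ?leq_pred// insubF ?ltnn// eqxx.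
Qed.

(** For [d = 0] the indices [d.-1] and [d] would coincide and [z] would be lost; this is where
    [d_gt0] enters. *)
Lemma xyz_zE x y z : xyz x y z ord_max 0 = z.
Proof.
rewrite mxE /= insubF; last by apply/negbTE; rewrite -leqNgt leq_pred.
by rewrite -{1}(prednK d_gt0) eqn_leq ltnn.
Qed.

Lemma xyz_eta c : xyz (xpart c) (c (inord d.-1) 0) (c ord_max 0) = c.
Proof.
apply/colP => i; rewrite mxE; case: insubP => [j _ ij|].
  by rewrite mxE ij inord_val.
rewrite -leqNgt leq_eqVlt => /orP[/eqP ->|lt_di]; first by rewrite eqxx inord_val.
rewrite gtn_eqF//; congr (c _ 0); apply/val_inj/eqP => /=.
by rewrite eqn_leq -{1}(prednK d_gt0) lt_di -ltnS ltn_ord.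
Qed.

Lemma xyzD x y z x' y' z' :
  xyz x y z + xyz x' y' z' = xyz (x + x') (y + y') (z + z').
Proof.
by apply/colP => i; rewrite !mxE; case: insub => [j|]; [rewrite mxE|case: ifP].
Qed.

Lemma rscale_xyz x y z a :
  rscale (xyz x y z) a = xyz (rscale x a) (y * a) (z * a).
Proof.
apply/colP => i; rewrite rscaleE !mxE.
by case: insub => [j|]; [rewrite rscaleE|case: ifP].
Qed.

Lemma xyz_inj x y z x' y' z' : xyz x y z = xyz x' y' z' ->
  [/\ x = x', y = y' & z = z'].
Proof.
move=> e; split.
- by rewrite -(xpart_xyz x y z) e xpart_xyz.
- by rewrite -(xyz_yE x y z) e xyz_yE.
- by rewrite -(xyz_zE x y z) e xyz_zE.
Qed.

Lemma xyz0 : xyz 0 0 0 = 0 :> 'cV[D]_d.+1.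
Proof. by apply/colP => i; rewrite !mxE; case: insub => [j|]; rewrite ?mxE ?if_same. Qed.

Lemma xyz_split x y z :
  xyz x y z = xyz x 0 0 + rscale (xyz 0 1 0) y + rscale (xyz 0 0 1) z.
Proof.
by rewrite !rscale_xyz !xyzD !rscale0r !mul0r !mul1r !addr0 !add0r.
Qed.

Lemma xyz_neq0 x y z : [\/ x != 0, y != 0 | z != 0] -> xyz x y z != 0.
Proof.
by move=> h; apply/eqP; rewrite -xyz0 => /xyz_inj[x0 y0 z0];
  move: h; rewrite x0 y0 z0 !eqxx => -[].
Qed.

Lemma hpoint_proj U x y z : columns_basis U -> xyz x y z != 0 ->
  projective_space (hpoint U x y z).
Proof.
by move=> bU c0; exists (U *m xyz x y z); rewrite //= mulmx_basis_eq0.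
Qed.

Lemma projP U p : columns_basis U -> projective_space p ->
  exists x y z, xyz x y z != 0 /\ p = hpoint U x y z.
Proof.
move=> bU [v v0 <-]; have [_ /(_ v)[c vE]] := bU.
exists (xpart c), (c (inord d.-1) 0), (c ord_max 0).
rewrite /hpoint xyz_eta -vE; split=> //.
by apply: contra_neq v0 => c0; rewrite vE c0 mulmx0.
Qed.

Lemma hpoint_rscale U x y z a : a != 0 ->
  hpoint U (rscale x a) (y * a) (z * a) = hpoint U x y z.
Proof.
by move=> a0; rewrite /hpoint -rscale_xyz mulmx_rscale right_span_rscale.
Qed.

Lemma hpoint_inj U x y z x' y' z' : columns_basis U -> xyz x' y' z' != 0 ->
  hpoint U x y z = hpoint U x' y' z' ->
  exists2 a, a != 0 & [/\ x' = rscale x a, y' = y * a & z' = z * a].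
Proof.
move=> bU c0 /right_span_inj; rewrite mulmx_basis_eq0// => /(_ c0)[a a0].
rewrite -mulmx_rscale => /eqP; rewrite -subr_eq0 -mulmxBr mulmx_basis_eq0//.
by rewrite subr_eq0 rscale_xyz => /eqP/xyz_inj ?; exists a.
Qed.

Lemma hpoint_y1_inj U z : columns_basis U -> injective (fun x => hpoint U x 1 z).
Proof.
move=> bU x x' /hpoint_inj; case=> // [|a _ [-> a1 _]].
  by apply: xyz_neq0; rewrite oner_neq0; constructor 2.
by move: a1; rewrite mul1r => <-; rewrite rscale1.
Qed.

Lemma hpoint_z1_inj U y : columns_basis U -> injective (fun x => hpoint U x y 1).
Proof.
move=> bU x x' /hpoint_inj; case=> // [|a _ [-> _ a1]].
  by apply: xyz_neq0; rewrite oner_neq0; constructor 3.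
by move: a1; rewrite mul1r => <-; rewrite rscale1.
Qed.

(** [locus] quantifies over all coordinate vectors of a point; a condition stable under right
    scaling need only be tested on one of them. *)
Lemma locus_hpoint U (e : 'cV[D]_d.+1 -> Prop) x y z :
    columns_basis U -> (forall c a, e c -> e (rscale c a)) -> xyz x y z != 0 ->
  locus U e (hpoint U x y z) <-> e (xyz x y z).
Proof.
move=> bU e_rscale c0; split=> [[_]|exyz]; first by apply; apply: right_span_id.
split; first exact: hpoint_proj.
move=> c [a _]; rewrite -mulmx_rscale => /eqP.
rewrite -subr_eq0 -mulmxBr mulmx_basis_eq0// subr_eq0 => /eqP <-.
exact: e_rscale.
Qed.

Lemma xd_eq0P U x y z : columns_basis U -> xyz x y z != 0 ->
  xd_eq0 U (hpoint U x y z) <-> y = 0.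
Proof.
move=> bU c0; rewrite /xd_eq0 locus_hpoint// ?xyz_yE// => c a ca.
by rewrite rscaleE ca mul0r.
Qed.

Lemma xd_eq_xd1P U x y z : columns_basis U -> xyz x y z != 0 ->
  xd_eq_xd1 U (hpoint U x y z) <-> y = z.
Proof.
move=> bU c0; rewrite /xd_eq_xd1 locus_hpoint// ?xyz_yE ?xyz_zE// => c a ca.
by rewrite !rscaleE ca.
Qed.

Lemma xd1_eq0P U x y z : columns_basis U -> xyz x y z != 0 ->
  xd1_eq0 U (hpoint U x y z) <-> z = 0.
Proof.
move=> bU c0; rewrite /xd1_eq0 locus_hpoint// ?xyz_zE// => c a ca.
by rewrite rscaleE ca mul0r.
Qed.

Lemma proj_subset_eq U (A B : set (proj_point D d)) : columns_basis U ->
    A `<=` @projective_space D d -> B `<=` @projective_space D d ->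
    (forall x y z, xyz x y z != 0 -> A (hpoint U x y z) <-> B (hpoint U x y z)) ->
  A = B.
Proof.
move=> bU Ap Bp AB; apply/seteqP; split=> p.
  by move=> Ap'; have [x [y [z [c0 pE]]]] := projP bU (Ap _ Ap'); rewrite pE in Ap' *; apply/AB.
by move=> Bp'; have [x [y [z [c0 pE]]]] := projP bU (Bp _ Bp'); rewrite pE in Bp' *; apply/AB.
Qed.

Lemma locus_proj U e : @locus D d U e `<=` @projective_space D d.
Proof. by move=> p []. Qed.

Lemma hyperplane_proj H : hyperplane H -> H `<=` @projective_space D d.
Proof. by move=> [alpha _ ->]; apply: locus_proj. Qed.

Lemma locus1_right_span (alpha : 'rV[D]_d.+1) v : v != 0 ->
  locus 1%:M (fun c => alpha *m c = 0) (right_span v) <-> alpha *m v = 0.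
Proof.
move=> v0; split=> [[_ h]|av0]; first by apply: h; rewrite mul1mx; apply: right_span_id.
split; first by exists v.
by move=> c; rewrite mul1mx => -[a _ <-]; rewrite mulmx_rscale av0 rscale0r.
Qed.

Lemma cV1_rscale (u : 'cV[D]_1) a : rscale u a = (u 0 0 * a)%:M.
Proof. by apply/colP => i; rewrite rscaleE !mxE !ord1 eqxx. Qed.

(** A linear form that vanishes on all vectors [(x, 0, 0)] is determined by its values [s] and [t]
    on the last two basis vectors. Both cannot vanish, since [U] is invertible and the form is
    nonzero. *)
Lemma hyperplane_pencil U H : columns_basis U -> hyperplane H ->
    (forall x, x != 0 -> H (hpoint U x 0 0)) ->
  exists s t, ~ (s = 0 /\ t = 0) /\
    forall x y z, xyz x y z != 0 -> H (hpoint U x y z) <-> s * y + t * z = 0.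
Proof.
move=> bU [alpha alpha0 ->] Hx.
have {}Hx x : alpha *m (U *m xyz x 0 0) = 0.
  have [->|x0] := eqVneq x 0; first by rewrite xyz0 !mulmx0.
  have := Hx _ x0; rewrite locus1_right_span// mulmx_basis_eq0//.
  by apply: xyz_neq0; constructor.
pose s := (alpha *m (U *m xyz 0 1 0)) 0 0.
pose t := (alpha *m (U *m xyz 0 0 1)) 0 0.
have stE x y z : alpha *m (U *m xyz x y z) = (s * y + t * z)%:M.
  by rewrite xyz_split !mulmxDr !mulmx_rscale Hx add0r !cV1_rscale raddfD.
exists s, t; split=> [[s0 t0]|x y z c0].
  case/negP: alpha0; have [W [UW _]] := basis_inverse bU.
  apply/eqP; rewrite -[alpha]mulmx1 -UW mulmxA.
  suff -> : alpha *m U = 0 by rewrite mul0mx.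
  apply: mulmx_cV_inj => c; rewrite mul0mx -mulmxA -(xyz_eta c) stE s0 t0.
  by rewrite !mul0r addr0 raddf0.
rewrite locus1_right_span ?mulmx_basis_eq0// stE; split=> [/matrixP/(_ 0 0)|->].
  by rewrite !mxE.
by rewrite raddf0.
Qed.

(** [hyperplane] refers to the standard basis, so the form given in coordinates is composed with the
    inverse of [U]. *)
Lemma columns_basis_locus_hyperplane U s t : columns_basis U -> ~ (s = 0 /\ t = 0) ->
  hyperplane (locus U (fun c => s * c (inord d.-1) 0 + t * c ord_max 0 = 0)).
Proof.
move=> bU st; have [W [UW WU]] := basis_inverse bU.
pose beta : 'rV[D]_d.+1 :=
  s *: delta_mx 0 (inord d.-1) + t *: delta_mx 0 ord_max.
have betaE c : beta *m c = (s * c (inord d.-1) 0 + t * c ord_max 0)%:M.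
  rewrite mulmxDl -!scalemxAl -!rowE; apply/colP => i.
  by rewrite !mxE !ord1 eqxx mulr1n.
have alphaE c : beta *m W *m (U *m c) = beta *m c.
  by rewrite -mulmxA (mulmxA W) WU mul1mx.
exists (beta *m W).
  apply/eqP => a0; apply: st.
  have := alphaE (xyz 0 1 0); have := alphaE (xyz 0 0 1).
  rewrite a0 !mul0mx !betaE !xyz_yE !xyz_zE !mulr0 !mulr1 addr0 add0r.
  by move=> /matrixP/(_ 0 0) + /matrixP/(_ 0 0); rewrite !mxE.
apply: (proj_subset_eq bU); [exact: locus_proj|exact: locus_proj|] => x y z c0.
rewrite locus1_right_span ?mulmx_basis_eq0// alphaE locus_hpoint//; last first.
  by move=> c a; rewrite !rscaleE !mulrA -mulrDl => ->; rewrite mul0r.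
rewrite betaE; split=> [->|/matrixP/(_ 0 0)]; first by rewrite raddf0.
by rewrite !mxE.
Qed.

(** In a dependency the last two coordinates force the coefficients [a, -a, a] with [a] nonzero, and
    the first ones then give [(x - y + z) a = 0]. Conversely, if [y = x + z], the middle vector is
    the sum of the outer two, which are independent and span the line. *)
Lemma collinear_hpointP U (x y z : 'cV[D]_d.-1) : columns_basis U ->
  collinear (hpoint U x 0 1) (hpoint U y 1 1) (hpoint U z 1 0) <-> y = x + z.
Proof.
move=> bU; split=> [col|->].
  have [a [b [c [abc0]]]] := collinear_dependent skewD col
    (right_span_id _) (right_span_id _) (right_span_id _).
  rewrite -!mulmx_rscale -!mulmxDr => /eqP; rewrite mulmx_basis_eq0//.
  rewrite !rscale_xyz !xyzD -xyz0 => /eqP/xyz_inj[].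
  rewrite !mul0r !mul1r addr0 add0r => xyz_ /eqP.
  rewrite addr_eq0 => /eqP bc /eqP; rewrite addr_eq0 => /eqP ab.
  move: xyz_ abc0; rewrite ab bc opprK rscaleN => /eqP.
  rewrite addrAC subr_eq0 /rscale -mulmxDl -subr_eq0 -mulmxBl => /eqP.
  by move=> /(@rscale_eq0 _ skewD)[/eqP|->]; [rewrite subr_eq0 => /eqP <-|rewrite oppr0 => -[]].
have free (a b : D) : rscale (U *m xyz x 0 1) a + rscale (U *m xyz z 1 0) b = 0 ->
    a = 0 /\ b = 0.
  rewrite -!mulmx_rscale -mulmxDr => /eqP; rewrite mulmx_basis_eq0// => /eqP.
  by rewrite !rscale_xyz !xyzD -xyz0 => /xyz_inj[_]; rewrite !mul0r !mul1r add0r addr0.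
have [l lineL hl] := spanned_line free; exists l.
have E a b : rscale (U *m xyz x 0 1) a + rscale (U *m xyz z 1 0) b =
    U *m xyz (rscale x a + rscale z b) b a.
  by rewrite -!mulmx_rscale -mulmxDr !rscale_xyz !xyzD !mul0r !mul1r add0r addr0.
have {}hl a b : (a != 0) || (b != 0) -> l (hpoint U (rscale x a + rscale z b) b a).
  move=> ab; rewrite /hpoint -E; apply: hl; rewrite E mulmx_basis_eq0//.
  by apply: xyz_neq0; case/orP: ab => ?; [constructor 3|constructor 2].
split=> //.
- by have := hl 1 0; rewrite oner_neq0 rscale1 rscaler0 addr0; apply.
- by have := hl 1 1; rewrite oner_neq0 !rscale1; apply.
- by have := hl 0 1; rewrite oner_neq0 orbT rscale1 rscaler0 add0r; apply.
Qed.

End Coordinates.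

(** * Transversal designs with three parts *)

Section ThreeElementSets.
Variable T : Type.
Implicit Types (A : set T) (x y z : T).

Lemma set3CA x y z : [set x; y; z] = [set y; x; z].
Proof. by rewrite (setUC [set x]). Qed.

Lemma set3AC x y z : [set x; y; z] = [set x; z; y].
Proof. exact: setUAC. Qed.

Lemma card_eq3 A : A #= `I_3 ->
  exists x y z, [/\ x <> y, x <> z, y <> z & A = [set x; y; z]].
Proof.
move=> /card_set_bijP[f [fA finj fsurj]].
have [|x Ax fx] := fsurj 0%N; first by [].
have [|y Ay fy] := fsurj 1%N; first by [].
have [|z Az fz] := fsurj 2%N; first by [].
exists x, y, z; split; [congruence|congruence|congruence|].
apply/seteqP; split=> [t At|t [[->|->]|->]]//.
have : (f t < 3)%N := fA _ At.
by case ft: (f t) => [|[|[|]]]// _; [left; left|left; right|right];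
  apply: finj; rewrite ?inE// ?fx ?fy ?fz.
Qed.

(** If [x = y], three distinct elements would have to fit into [y] and [z]. Applied to the set of
    parts, this shows that the listed parts differ. *)
Lemma card_eq3_neq x y z : [set x; y; z] #= `I_3 -> x <> y.
Proof.
move=> /card_eq3[u [v [w [uv uw vw e]]]] xy.
have E t : [set x; y; z] t -> t = y \/ t = z.
  by rewrite xy => -[[]|]; [left|left|right].
have [[uE|uE] [vE|vE] [wE|wE]] : [/\ u = y \/ u = z, v = y \/ v = z & w = y \/ w = z].
  by split; apply: E; rewrite e; [left; left|left; right|right].
all: congruence.
Qed.

Lemma card_eq3_third A x y : A #= `I_3 -> A x -> A y -> x <> y ->
  exists z, [/\ A z, x <> z, y <> z & A = [set x; y; z]].
Proof.
move=> /card_eq3[u [v [w [uv uw vw ->]]]] [[]|] -> [[]|] -> //.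
- by exists w; split=> //; right.
- by exists v; split=> //; [left; right|congruence|rewrite set3AC].
- by exists w; split=> //; [right|rewrite set3CA].
- by exists u; split; [left; left|congruence|congruence|rewrite set3CA set3AC].
- by exists v; split; [left; right|congruence|congruence|rewrite set3AC set3CA].
- by exists u; split; [left; left|congruence|congruence|rewrite set3CA set3AC set3CA].
Qed.

End ThreeElementSets.

Section TransversalDesigns.
Variables (T : Type) (n : nat) (V : set T) (P B : set (set T)).
Implicit Types X : set T.
Hypothesis td : transversal_design 3 n V P B.

Lemma td_parts_disjoint X1 X2 X3 p : P = [set X1; X2; X3] -> X1 p -> X2 p -> False.
Proof.
have [_ _ [[_ triv _] P3 _] _ _] := td => PE X1p X2p.
apply: (@card_eq3_neq _ X1 X2 X3); first by rewrite -PE.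
by apply: (triv X1 X2); rewrite ?PE; [left; left|left; right|exists p].
Qed.

(** No part contains both points, so a unique block does. Its remaining point is in neither [X1] nor
    [X2], because two points of one part share no block. *)
Lemma td_third X1 X2 X3 p1 p2 : P = [set X1; X2; X3] -> X1 p1 -> X2 p2 ->
  exists! p3, X3 p3 /\ exists b, [/\ B b, b p1, b p2 & b p3].
Proof.
move=> PE Xp1 Xp2; have [_ _ [[coverP _ _] _ _] Bb pairs] := td.
have disj12 p := @td_parts_disjoint X1 X2 X3 p PE.
have disj13 p : X1 p -> X3 p -> False.
  by apply: (@td_parts_disjoint X1 X3 X2); rewrite PE set3AC.
have disj23 p : X2 p -> X3 p -> False.
  by apply: (@td_parts_disjoint X2 X3 X1); rewrite PE set3CA set3AC.
have PV X p : P X -> X p -> V p by rewrite -coverP; exists X.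
have PX1 : P X1 by rewrite PE; left; left.
have PX2 : P X2 by rewrite PE; left; right.
have noblock X p q : P X -> X p -> X q -> p <> q ->
    ~ exists b, [/\ B b, b p & b q].
  move=> PX Xp Xq pq bpq.
  by case: (pairs _ _ (PV _ _ PX Xp) (PV _ _ PX Xq) pq) => -[_]; [|case; exists X].
have p12 : p1 <> p2 by move=> e; apply: (disj12 p1); rewrite // e.
case: (pairs _ _ (PV _ _ PX1 Xp1) (PV _ _ PX2 Xp2) p12) => -[[X [[PX Xp1' Xp2'] uniqX]] _].
  by move: PX Xp1' Xp2'; rewrite PE => -[[]|] -> a1 a2; exfalso; eauto.
have [bV b3] := Bb _ PX.
have [q [Xq p1q p2q XE]] := card_eq3_third b3 Xp1' Xp2' p12.
exists q; split=> [|q' [X3q' [b' [Bb' b'p1 b'p2 b'q']]]].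
  split; last by exists X.
  have : V q by apply: bV.
  rewrite -coverP => -[Y]; rewrite {1}PE => -[[]|] -> // Yq.
  - by case: (noblock _ _ _ PX1 Xp1 Yq p1q); exists X.
  - by case: (noblock _ _ _ PX2 Xp2 Yq p2q); exists X.
move: b'q'; rewrite -(uniqX b')// XE => -[[]|] e; rewrite ?e//.
- by case: (disj13 p1); rewrite // -e.
- by case: (disj23 p2); rewrite // -e.
Qed.

End TransversalDesigns.

(** * Hyperplanes through a common axis *)

Section Pencil.
Variable D : unitRingType.
Hypothesis skewD : forall x : D, x != 0 -> x \is a GRing.unit.
Variable d : nat.
Hypothesis d_gt0 : (0 < d)%N.
Implicit Types (a b y z s t : D) (x : 'cV[D]_d.-1) (c v : 'cV[D]_d.+1).
Implicit Types (U M : 'M[D]_d.+1) (p : proj_point D d).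
Implicit Types (H : set (proj_point D d)) (G : set 'cV[D]_d.-1).

(** Each hyperplane contains the axis and so has an equation [s y + t z = 0]. Evaluating it at the
    reference point of that hyperplane gives [t = 0], [s + t = 0] and [s = 0], respectively. *)
Lemma adapted_equations H1 H2 H3 p1 p2 p3 U :
    hyperplane H1 -> hyperplane H2 -> hyperplane H3 ->
    H1 p1 -> H2 p2 -> H3 p3 -> adapted_basis H1 H2 H3 p1 p2 p3 U ->
  [/\ H1 = xd_eq0 U, H2 = xd_eq_xd1 U & H3 = xd1_eq0 U].
Proof.
move=> h1 h2 h3 H1p H2p H3p [bU HE p1E p2E p3E].
have Hx x : x != 0 -> (H1 `&` H2 `&` H3) (hpoint U x 0 0).
  by move=> x0; rewrite HE; exists x.
have xyz01 : xyz 0 0 1 != 0 :> 'cV[D]_d.+1.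
  by apply: xyz_neq0; rewrite // oner_neq0; constructor 3.
have xyz11 : xyz 0 1 1 != 0 :> 'cV[D]_d.+1.
  by apply: xyz_neq0; rewrite // oner_neq0; constructor 3.
have xyz10 : xyz 0 1 0 != 0 :> 'cV[D]_d.+1.
  by apply: xyz_neq0; rewrite // oner_neq0; constructor 2.
have mul_eq0 s y : s <> 0 -> s * y = 0 <-> y = 0.
  move=> s0; split=> [/eqP|->]; last by rewrite mulr0.
  by rewrite skew_mulf_eq0// => /orP[/eqP//|/eqP].
split.
- have [x /Hx[[]]//|s [t [st H1E]]] := hyperplane_pencil d_gt0 bU h1.
  move: H1p; rewrite p1E H1E// mulr0 mulr1 add0r => t0.
  apply: (proj_subset_eq d_gt0 bU); [exact: hyperplane_proj|exact: locus_proj|].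
  move=> x y z c0; rewrite H1E// xd_eq0P// t0 mul0r addr0 mul_eq0//.
  by move=> s0; apply: st.
- have [x /Hx[[]]//|s [t [st H2E]]] := hyperplane_pencil d_gt0 bU h2.
  move: H2p; rewrite p2E H2E// !mulr1 => /eqP; rewrite addrC addr_eq0 => /eqP t0.
  apply: (proj_subset_eq d_gt0 bU); [exact: hyperplane_proj|exact: locus_proj|].
  move=> x y z c0; rewrite H2E// xd_eq_xd1P// t0 mulNr -mulrBr mul_eq0.
    by split=> [/eqP|->]; rewrite ?subrr// subr_eq0 => /eqP.
  by move=> s0; apply: st; rewrite t0 s0 oppr0.
- have [x /Hx[[]]//|s [t [st H3E]]] := hyperplane_pencil d_gt0 bU h3.
  move: H3p; rewrite p3E H3E// mulr0 mulr1 addr0 => s0.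
  apply: (proj_subset_eq d_gt0 bU); [exact: hyperplane_proj|exact: locus_proj|].
  move=> x y z c0; rewrite H3E// xd1_eq0P// s0 mul0r add0r mul_eq0//.
  by move=> t0; apply: st.
Qed.

(** An equality of propositions, so that memberships can be rewritten under negations and
    conjunctions. *)
Lemma hyperplane_right_span (alpha : 'rV[D]_d.+1) v H : v != 0 ->
    H = locus 1%:M (fun c => alpha *m c = 0) ->
  H (right_span v) = (alpha *m v = 0).
Proof. by move=> v0 ->; apply/propext/locus1_right_span. Qed.

(** The basis consists of a basis of the axis and of representatives of [p3] and [p1], scaled so
    that their sum represents [p2]. The scaling comes from a dependency [v1 a + v2 b + v3 c = 0],
    whose coefficients are all nonzero because each point lies on just one of the hyperplanes. *)
Lemma adapted_basis_exists r H1 H2 H3 p1 p2 p3 : r.+1 = d.-1 ->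
    hyperplane H1 -> hyperplane H2 -> hyperplane H3 ->
    flat r (H1 `&` H2 `&` H3) -> collinear p1 p2 p3 ->
    [/\ projective_space p1, projective_space p2 & projective_space p3] ->
    [/\ H1 p1, ~ H2 p1 & ~ H3 p1] -> [/\ ~ H1 p2, H2 p2 & ~ H3 p2] ->
    [/\ ~ H1 p3, ~ H2 p3 & H3 p3] ->
  exists U, adapted_basis H1 H2 H3 p1 p2 p3 U.
Proof.
move=> rE [al1 _ H1E] [al2 _ H2E] [al3 _ H3E].
rewrite /flat rE => -[A [freeA FE]] col [pp1 pp2 pp3].
case: pp1 pp2 pp3 col => v1 v10 <- [v2 v20 <-] [v3 v30 <-] col.
have H1P v (v0 : v != 0) := hyperplane_right_span v0 H1E.
have H2P v (v0 : v != 0) := hyperplane_right_span v0 H2E.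
have H3P v (v0 : v != 0) := hyperplane_right_span v0 H3E.
rewrite !H1P// !H2P// !H3P// => -[al11 al21 al31] [al12 al22 al32] [al13 al23 al33].
have [a [b [c [abc0 dep]]]] := collinear_dependent skewD col
  (right_span_id _) (right_span_id _) (right_span_id _).
have al_dep (al : 'rV_d.+1) :
    rscale (al *m v1) a + rscale (al *m v2) b + rscale (al *m v3) c = 0.
  by rewrite -!mulmx_rscale -!mulmxDr dep mulmx0.
have rs0 m (v : 'cV[D]_m) e : v <> 0 -> rscale v e = 0 -> e = 0.
  by move=> v0 /(rscale_eq0 skewD)[].
(* If [a = 0], the form of [H2] kills [v2] and leaves [c = 0], while the form of [H3] kills [v3] and
   leaves [b = 0]. The cases of [b] and [c] are analogous. *)
have a0 : a != 0.
  apply/eqP => a0; apply: abc0.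
  move: (al_dep al2) (al_dep al3).
  rewrite a0 !rscaler0 !add0r al22 al33 !rscale0r add0r addr0.
  by move=> /(rs0 _ _ _ al23) -> /(rs0 _ _ _ al32) ->.
have b0 : b != 0.
  apply/eqP => b0; apply: abc0.
  move: (al_dep al1) (al_dep al3).
  rewrite b0 !rscaler0 !addr0 al11 al33 !rscale0r add0r addr0.
  by move=> /(rs0 _ _ _ al13) -> /(rs0 _ _ _ al31) ->.
have c0 : c != 0.
  apply/eqP => c0; apply: abc0.
  move: (al_dep al1) (al_dep al2).
  rewrite c0 !rscaler0 !addr0 al11 al22 !rscale0r add0r addr0.
  by move=> /(rs0 _ _ _ al12) -> /(rs0 _ _ _ al21) ->.
(* [X] projects onto the first [d.-1] coordinates; writing [U] as a sum of products avoids casts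
   between matrix sizes. *)
pose X : 'M[D]_(d.-1, d.+1) := rowsub (fun j : 'I_d.-1 => inord j) 1%:M.
have XE u : X *m u = xpart u.
  by rewrite mul_rowsub_mx mul1mx; apply/colP => j; rewrite !mxE.
pose e := rscale v3 c; pose f := rscale v1 a.
pose U : 'M[D]_d.+1 :=
  A *m X + e *m delta_mx 0 (inord d.-1) + f *m delta_mx 0 ord_max.
have deltaE (u : 'cV[D]_d.+1) i : (delta_mx 0 i : 'rV[D]_d.+1) *m u = (u i 0)%:M.
  by rewrite -rowE; apply/colP => j; rewrite !mxE !ord1 eqxx.
have UE x y z : U *m xyz x y z = A *m x + rscale e y + rscale f z.
  rewrite !mulmxDl -!mulmxA !deltaE XE xpart_xyz// xyz_yE xyz_zE//.
  by rewrite /e /f /rscale !mulmxA.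
have A0 x : x != 0 -> A *m x != 0.
  by apply: contra_neq => /freeA.
have AE x : [/\ al1 *m (A *m x) = 0, al2 *m (A *m x) = 0 & al3 *m (A *m x) = 0].
  have [->|x0] := eqVneq x 0; first by rewrite !mulmx0.
  have : (H1 `&` H2 `&` H3) (right_span (A *m x)).
    rewrite FE; split; first by exists (A *m x); rewrite //= A0.
    by move=> _ [t _ <-]; rewrite -mulmx_rscale; exists (rscale x t).
  by move=> [[]]; rewrite H1P ?A0// H2P ?A0// H3P ?A0.
(* The form of [H1] kills the axis and [f] but not [e], which isolates the coordinate [y]; the form
   of [H3] isolates [z] likewise. The rest is freeness of [A]. *)
have bU : columns_basis U.
  apply: (square_free_basis skewD) => u; rewrite -(xyz_eta d_gt0 u) UE => Uu.
  have [aA1 aA2 aA3] := AE (xpart u).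
  have /rs0 y0 : rscale (al1 *m e) (u (inord d.-1) 0) = 0.
    have := congr1 (mulmx al1) Uu.
    rewrite !mulmxDr !mulmx_rscale aA1 al11 !rscale0r mulmx0 addr0 add0r.
    by rewrite -mulmx_rscale.
  have /rs0 z0 : rscale (al3 *m f) (u ord_max 0) = 0.
    have := congr1 (mulmx al3) Uu.
    rewrite !mulmxDr !mulmx_rscale aA3 al33 !rscale0r mulmx0 !add0r.
    by rewrite -mulmx_rscale.
  rewrite y0 ?z0 in Uu *; last 2 first.
  - by rewrite mulmx_rscale => /(rscale_eq0 skewD)[]//; apply/eqP.
  - by rewrite mulmx_rscale => /(rscale_eq0 skewD)[]//; apply/eqP.
  by move: Uu; rewrite !rscaler0 !addr0 => /freeA ->; rewrite xyz0.
exists U; split=> //.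
- rewrite FE; apply/seteqP; split=> p.
    move=> [[v v0 <-] /(_ _ (right_span_id _))[x _ xE]].
    exists x; first by apply: contra_neq v0 => x0; rewrite -xE x0 mulmx0.
    by rewrite /hpoint UE !rscaler0 !addr0 xE.
  move=> [x x0 <-]; rewrite /hpoint UE !rscaler0 !addr0.
  split; first by exists (A *m x); rewrite //= A0.
  by move=> _ [t _ <-]; rewrite -mulmx_rscale; exists (rscale x t).
- by rewrite /hpoint UE mulmx0 rscaler0 !add0r rscale1 right_span_rscale.
- rewrite /hpoint UE mulmx0 add0r !rscale1 -(right_span_rscale skewD v2 b0).
  (* The dependency reads [e + f = - v2 b], so the sign is absorbed as a scalar. *)
  rewrite -(right_span_rscale skewD _ (_ : -1 != 0)) ?oppr_eq0 ?oner_neq0//.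
  rewrite rscaleN rscale1; congr right_span.
  by apply/eqP; rewrite eq_sym -addr_eq0 -dep addrC addrA [f + _]addrC addrAC.
- by rewrite /hpoint UE mulmx0 rscaler0 addr0 add0r rscale1 right_span_rscale.
Qed.

End Pencil.

(** * The group of a design *)

Section CoordinateGroups.
Variable D : unitRingType.
Hypothesis skewD : forall x : D, x != 0 -> x \is a GRing.unit.
Variable d : nat.
Hypothesis d_gt0 : (0 < d)%N.
Implicit Types (a b s t : D) (x y z : 'cV[D]_d.-1) (c v : 'cV[D]_d.+1).
Implicit Types (U M : 'M[D]_d.+1) (p : proj_point D d).
Implicit Types (H V : set (proj_point D d)) (G : set 'cV[D]_d.-1).

Lemma additive_subgroup0 n G : additive_subgroup n G -> G 0.
Proof. by move=> [[G0 _] _]; move: G0; rewrite inE. Qed.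

Lemma additive_subgroupB n G x y : additive_subgroup n G -> G x -> G y -> G (x - y).
Proof.
by move=> [[_ GB] _] Gx Gy; have := GB x y; rewrite !inE; apply.
Qed.

Lemma additive_subgroupN n G x : additive_subgroup n G -> G x -> G (- x).
Proof.
move=> sG Gx; rewrite -[- x]add0r; apply: (additive_subgroupB sG) => //.
exact: additive_subgroup0 sG.
Qed.

Lemma additive_subgroupD n G x y : additive_subgroup n G -> G x -> G y -> G (x + y).
Proof.
move=> sG Gx Gy; rewrite -[y]opprK; apply: (additive_subgroupB sG) => //.
exact: additive_subgroupN sG Gy.
Qed.

Lemma hpoint_part1 U G x : columns_basis U -> part1 U G (hpoint U x 0 1) <-> G x.
Proof.
move=> bU; split=> [[y Gy /(hpoint_z1_inj d_gt0 bU) <-//]|Gx].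
by exists x.
Qed.

Lemma coordinate_group_unique n V H1 H2 H3 U G G' : columns_basis U ->
  coordinate_group n V H1 H2 H3 U G -> coordinate_group n V H1 H2 H3 U G' -> G = G'.
Proof.
move=> bU [_ [GE _ _]] [_ [G'E _ _]]; apply/seteqP.
by split=> x; rewrite -(hpoint_part1 G x bU) -(hpoint_part1 G' x bU) -GE G'E.
Qed.

(** * Changes of coordinates that preserve two hyperplanes *)

Section Transition.
Variables U1 U2 : 'M[D]_d.+1.
Hypotheses (bU1 : columns_basis U1) (bU2 : columns_basis U2).
Hypothesis eq_xd : xd_eq0 U1 = xd_eq0 U2.
Hypothesis eq_xd1 : xd1_eq0 U1 = xd1_eq0 U2.

(** The vanishing of [y] or of [z] expresses membership in a locus that is the same for both
    bases. *)
Lemma transition_coordinates x (y z : D) : xyz x y z != 0 ->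
  exists x' (y' z' : D), [/\ U2 *m xyz x y z = U1 *m xyz x' y' z',
    y' = 0 <-> y = 0 & z' = 0 <-> z = 0].
Proof.
move=> c0; have [_ /(_ (U2 *m xyz x y z))[c UE]] := bU1.
exists (xpart c), (c (inord d.-1) 0), (c ord_max 0).
have c'0 : xyz (xpart c) (c (inord d.-1) 0) (c ord_max 0) != 0.
  by rewrite xyz_eta// -(mulmx_basis_eq0 _ bU1) -UE mulmx_basis_eq0.
have hE : hpoint U2 x y z = hpoint U1 (xpart c) (c (inord d.-1) 0) (c ord_max 0).
  by rewrite /hpoint xyz_eta// UE.
split; first by rewrite xyz_eta.
  by rewrite -(xd_eq0P bU1 c'0) -(xd_eq0P bU2 c0) eq_xd hE.
by rewrite -(xd1_eq0P d_gt0 bU1 c'0) -(xd1_eq0P d_gt0 bU2 c0) eq_xd1 hE.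
Qed.

(** Vectors of the axis have [y = z = 0] in both bases, so [T] is the corresponding block of the
    matrix that converts coordinates; [E] embeds the axis coordinates and [X] projects onto them. *)
Lemma transition_matrix : exists T : 'M[D]_d.-1,
  forall x, U2 *m xyz x 0 0 = U1 *m xyz (T *m x) 0 0.
Proof.
pose E : 'M[D]_(d.+1, d.-1) := \matrix_(i, j) xyz (delta_mx j 0) 0 0 i 0.
have EE x : xyz x 0 0 = E *m x.
  apply/colP => i; rewrite !mxE; case: insubP => [k _ ki|ki].
    rewrite (bigD1 k)//= !mxE -ki valK mxE !eqxx mul1r big1 ?addr0// => j jk.
    by rewrite !mxE -ki valK mxE eq_sym (negPf jk) mul0r.
  by rewrite if_same big1// => j _; rewrite !mxE insubN// if_same mul0r.
pose X : 'M[D]_(d.-1, d.+1) := rowsub (fun j : 'I_d.-1 => inord j) 1%:M.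
have XE u : X *m u = xpart u.
  by rewrite mul_rowsub_mx mul1mx; apply/colP => j; rewrite !mxE.
have [W1 [UW1 WU1]] := basis_inverse bU1.
exists (X *m W1 *m U2 *m E) => x.
have [->|x0] := eqVneq x 0; first by rewrite mulmx0 xyz0 !mulmx0.
have [|x' [y' [z' [UE y0 z0]]]] := @transition_coordinates x 0 0.
  by apply: xyz_neq0 => //; constructor 1.
rewrite (proj2 y0 erefl) (proj2 z0 erefl) in UE.
rewrite -!mulmxA -EE UE !mulmxA -(mulmxA X) WU1 mulmx1 XE xpart_xyz//.
Qed.

End Transition.

Lemma coordinate_groups_equivalent n V H1 H2 H3 U1 U2 G1 G2 :
    columns_basis U1 -> columns_basis U2 ->
    H1 = xd_eq0 U1 -> H1 = xd_eq0 U2 -> H3 = xd1_eq0 U1 -> H3 = xd1_eq0 U2 ->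
    coordinate_group n V H1 H2 H3 U1 G1 -> coordinate_group n V H1 H2 H3 U2 G2 ->
  exists a (T : 'M[D]_d.-1),
    [/\ a != 0, general_linear T & G1 = [set rscale (T *m g) a | g in G2]].
Proof.
move=> bU1 bU2 H1U1 H1U2 H3U1 H3U2 [sG1 [P1 _ _]] [sG2 [P2 _ _]].
have eq_xd : xd_eq0 U1 = xd_eq0 U2 by rewrite -H1U1.
have eq_xd1 : xd1_eq0 U1 = xd1_eq0 U2 by rewrite -H3U1.
have [T TE] := transition_matrix bU1 bU2 eq_xd eq_xd1.
have [S SE] := transition_matrix bU2 bU1 (esym eq_xd) (esym eq_xd1).
have c001 : xyz 0 0 1 != 0 :> 'cV[D]_d.+1.
  by apply: xyz_neq0 => //; constructor 3; apply: oner_neq0.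
(* In the first basis the last vector of the second one is [(w, 0, s)]; it is not in [H3], so [s] is
   nonzero. *)
have [w [y [s [UE y0 s0]]]] := transition_coordinates bU1 bU2 eq_xd eq_xd1 c001.
rewrite (proj2 y0 erefl) {y0} in UE.
have {}s0 : s != 0 by apply/eqP => /s0/eqP; rewrite oner_eq0.
have us := skewD s0.
have inj0 (U : 'M[D]_d.+1) x x' : columns_basis U ->
    U *m xyz x 0 0 = U *m xyz x' 0 0 -> x = x'.
  move=> bU /eqP; rewrite -subr_eq0 -mulmxBr mulmx_basis_eq0// subr_eq0.
  by move=> /eqP/(xyz_inj d_gt0)[].
(* The induced map on the points [[x,0,1]], with the last coordinate renormalised to 1. It maps [G2]
   onto [G1]. *)
pose h x := rscale (T *m x + w) s^-1.
have hE x : hpoint U2 x 0 1 = hpoint U1 (h x) 0 1.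
  rewrite -(hpoint_rscale skewD U1 (h x) 0 1 s0) /h rscaleA mulVr// rscale1.
  rewrite mul0r mul1r /hpoint; congr right_span.
  have -> : xyz x 0 1 = xyz x 0 0 + xyz 0 0 1 :> 'cV[D]_d.+1.
    by rewrite xyzD !addr0 add0r.
  by rewrite mulmxDr TE UE -mulmxDr xyzD !addr0 add0r.
have hG x : G2 x -> G1 (h x).
  by move=> G2x; rewrite -(hpoint_part1 _ _ bU1) -hE -P1 P2; exists x.
have Gh x : G1 x -> exists2 g, G2 g & h g = x.
  move=> G1x; have : part1 U2 G2 (hpoint U1 x 0 1) by rewrite -P2 P1; exists x.
  by move=> [g G2g]; rewrite hE => /(hpoint_z1_inj d_gt0 bU1); exists g.
have hw g : h g = rscale (T *m g) s^-1 + h 0.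
  by rewrite /h mulmx0 add0r /rscale mulmxDl.
have Gw : G1 (h 0) by apply/hG/(additive_subgroup0 sG2).
exists s^-1, T; split.
- by apply: contra_neq s0 => s0; rewrite -(invrK s) s0 invr0.
(* The transition in the opposite direction inverts [T]. *)
- exists S; split; apply: mulmx_cV_inj => x; rewrite mul1mx -mulmxA.
    by apply: (inj0 U1) => //; rewrite -TE -SE.
  by apply: (inj0 U2) => //; rewrite -SE -TE.
apply/seteqP; split=> [x G1x|_ [g G2g <-]].
  (* A preimage of [x + h 0], rather than of [x], makes the translation cancel. *)
  have [g G2g] := Gh _ (additive_subgroupD sG1 G1x Gw).
  by rewrite hw => /addIr; exists g.
rewrite -[rscale _ _](addrK (h 0)) -hw.
by apply: (additive_subgroupB sG1) => //; apply: hG.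
Qed.

(** * Recovering the group from the blocks *)

Section GroupOfDesign.
Variables (n : nat) (V : set (proj_point D d)) (P B : set (set (proj_point D d))).
Variable U : 'M[D]_d.+1.
Hypothesis td : transversal_design 3 n V P B.
Hypothesis bU : columns_basis U.
Hypothesis V_proj : V `<=` @projective_space D d.
Hypothesis PE : P = [set V `&` xd_eq0 U; V `&` xd_eq_xd1 U; V `&` xd1_eq0 U].
Hypothesis block_collinear :
  forall (b : set (proj_point D d)) p1 p2 p3, B b -> b p1 -> b p2 -> b p3 -> collinear p1 p2 p3.

Lemma xyz_z1_neq0 x (y : D) : xyz x y 1 != 0.
Proof. by apply: xyz_neq0 => //; constructor 3; apply: oner_neq0. Qed.

Lemma xyz_y1_neq0 x (z : D) : xyz x 1 z != 0.
Proof. by apply: xyz_neq0 => //; constructor 2; apply: oner_neq0. Qed.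

(** With [y = 0], also having [z = 0] would put the point in two disjoint parts. So [z] is nonzero
    and can be scaled to 1. The other two parts are treated in the same way. *)
Lemma design_part1 p : (V `&` xd_eq0 U) p -> exists x, p = hpoint U x 0 1.
Proof.
move=> [Vp]; have [x [y [z [c0 pE]]]] := projP d_gt0 bU (V_proj Vp).
rewrite pE xd_eq0P// => y0; rewrite y0 in pE c0 *.
have [z0|z0] := eqVneq z 0; last first.
  exists (rscale x z^-1); rewrite -[RHS](hpoint_rscale skewD _ _ _ _ z0).
  by rewrite rscaleA mulVr ?rscale1 ?mul0r ?mul1r//; apply: skewD.
by case: (td_parts_disjoint td PE (p := p)); split;
  rewrite // pE ?xd_eq0P ?xd_eq_xd1P.
Qed.

Lemma design_part2 p : (V `&` xd_eq_xd1 U) p -> exists x, p = hpoint U x 1 1.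
Proof.
move=> [Vp]; have [x [y [z [c0 pE]]]] := projP d_gt0 bU (V_proj Vp).
rewrite pE xd_eq_xd1P// => y0; rewrite y0 in pE c0 *.
have [z0|z0] := eqVneq z 0; last first.
  exists (rscale x z^-1); rewrite -[RHS](hpoint_rscale skewD _ _ _ _ z0).
  by rewrite rscaleA mulVr ?rscale1 ?mul0r ?mul1r//; apply: skewD.
by case: (td_parts_disjoint td PE (p := p)); split;
  rewrite // pE ?xd_eq0P ?xd_eq_xd1P.
Qed.

Lemma design_part3 p : (V `&` xd1_eq0 U) p -> exists x, p = hpoint U x 1 0.
Proof.
move=> [Vp]; have [x [y [z [c0 pE]]]] := projP d_gt0 bU (V_proj Vp).
rewrite pE xd1_eq0P// => y0; rewrite y0 in pE c0 *.
have [z0|z0] := eqVneq y 0; last first.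
  exists (rscale x y^-1); rewrite -[RHS](hpoint_rscale skewD _ _ _ _ z0).
  by rewrite rscaleA mulVr ?rscale1 ?mul0r ?mul1r//; apply: skewD.
have PE' : P = [set V `&` xd_eq0 U; V `&` xd1_eq0 U; V `&` xd_eq_xd1 U].
  by rewrite PE set3AC.
by case: (td_parts_disjoint td PE' (p := p)); split;
  rewrite // pE ?xd_eq0P ?xd1_eq0P.
Qed.

Lemma hpoint_xd_eq0 x : xd_eq0 U (hpoint U x 0 1).
Proof. by apply/(xd_eq0P bU (xyz_z1_neq0 _ _)). Qed.

Lemma hpoint_xd_eq_xd1 x : xd_eq_xd1 U (hpoint U x 1 1).
Proof. by apply/(xd_eq_xd1P d_gt0 bU (xyz_z1_neq0 _ _)). Qed.

Lemma hpoint_xd1_eq0 x : xd1_eq0 U (hpoint U x 1 0).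
Proof. by apply/(xd1_eq0P d_gt0 bU (xyz_y1_neq0 _ _)). Qed.

(** The block through two points of different parts supplies a point of the third part, whose
    coordinate is forced by the collinearity relation [y = x + z]. The next two lemmas solve this
    relation for the other unknowns. *)
Lemma design_close3 x y : V (hpoint U x 0 1) -> V (hpoint U y 1 1) ->
  V (hpoint U (y - x) 1 0).
Proof.
move=> Vx Vy; have [||q [[Hq [b [Bb bx bY bq]]] _]] :=
  td_third td PE (p1 := hpoint U x 0 1) (p2 := hpoint U y 1 1).
- by split=> //; apply: hpoint_xd_eq0.
- by split=> //; apply: hpoint_xd_eq_xd1.
have [z qE] := design_part3 Hq.
move: (block_collinear Bb bx bY bq); rewrite qE collinear_hpointP// => ->.
by rewrite addrC addKr -qE; case: Hq.
Qed.

Lemma design_close2 x z : V (hpoint U x 0 1) -> V (hpoint U z 1 0) ->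
  V (hpoint U (x + z) 1 1).
Proof.
have PE' : P = [set V `&` xd_eq0 U; V `&` xd1_eq0 U; V `&` xd_eq_xd1 U].
  by rewrite PE set3AC.
move=> Vx Vy; have [||q [[Hq [b [Bb bx bY bq]]] _]] :=
  td_third td PE' (p1 := hpoint U x 0 1) (p2 := hpoint U z 1 0).
- by split=> //; apply: hpoint_xd_eq0.
- by split=> //; apply: hpoint_xd1_eq0.
have [y qE] := design_part2 Hq.
move: (block_collinear Bb bx bq bY); rewrite qE collinear_hpointP// => <-.
by rewrite -qE; case: Hq.
Qed.

Lemma design_close1 y z : V (hpoint U y 1 1) -> V (hpoint U z 1 0) ->
  V (hpoint U (y - z) 0 1).
Proof.
have PE' : P = [set V `&` xd_eq_xd1 U; V `&` xd1_eq0 U; V `&` xd_eq0 U].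
  by rewrite PE set3CA set3AC.
move=> Vx Vy; have [||q [[Hq [b [Bb bx bY bq]]] _]] :=
  td_third td PE' (p1 := hpoint U y 1 1) (p2 := hpoint U z 1 0).
- by split=> //; apply: hpoint_xd_eq_xd1.
- by split=> //; apply: hpoint_xd1_eq0.
have [x qE] := design_part1 Hq.
move: (block_collinear Bb bq bx bY); rewrite qE collinear_hpointP// => ->.
by rewrite addrK -qE; case: Hq.
Qed.

Lemma coordinate_group_exists :
    V (hpoint U 0 0 1) -> V (hpoint U 0 1 1) -> V (hpoint U 0 1 0) ->
  exists G, coordinate_group n V (xd_eq0 U) (xd_eq_xd1 U) (xd1_eq0 U) U G.
Proof.
move=> V1 V2 V3; pose G := [set x | V (hpoint U x 0 1)].
(* Blocks through [[o,1,0]] match the first two parts with equal coordinates; below, blocks through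
   [[o,1,1]] match the first and third parts with opposite ones. *)
have G2 x : V (hpoint U x 1 1) <-> G x.
  split=> Vx; first by have := design_close1 Vx V3; rewrite subr0.
  by have := design_close2 Vx V3; rewrite addr0.
have G3 x : V (hpoint U (- x) 1 0) <-> G x.
  split=> Vx; first by have := design_close1 V2 Vx; rewrite sub0r opprK.
  by have := design_close3 Vx V2; rewrite sub0r.
have P1 : xd_eq0 U `&` V = part1 U G.
  apply/seteqP; split=> [p [Hp Vp]|_ [x Gx <-]].
    by have [x pE] := design_part1 (conj Vp Hp); exists x; rewrite ?pE// /G/= -pE.
  by split=> //; apply: hpoint_xd_eq0.
have P2 : xd_eq_xd1 U `&` V = part2 U G.
  apply/seteqP; split=> [p [Hp Vp]|_ [x /G2 Gx <-]].
    by have [x pE] := design_part2 (conj Vp Hp); exists x => //; apply/G2; rewrite -pE.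
  by split=> //; apply: hpoint_xd_eq_xd1.
have P3 : xd1_eq0 U `&` V = part3 U G.
  apply/seteqP; split=> [p [Hp Vp]|_ [x /G3 Gx <-]].
    have [x pE] := design_part3 (conj Vp Hp); exists (- x); rewrite ?opprK//.
    by apply/G3; rewrite opprK -pE.
  by split=> //; apply: hpoint_xd1_eq0.
exists G; split=> //; split.
  (* For the difference, [y] is read in the second part; the block through [[x,0,1]] and [[y,1,1]]
     then meets the third part in [[y - x,1,0]]. *)
  split=> [|x y]; rewrite !inE// => Gx /G2 Gy.
  by apply/G3; rewrite opprB; apply: design_close3.
have [_ _ [_ _ /(_ (V `&` xd_eq0 U))]] := td.
rewrite setIC P1 => cardP _ _; apply: card_eq_trans (cardP _); last first.
  by rewrite -P1 setIC PE; left; left.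
by rewrite card_eq_sym inj_card_eq// => x y _ _; apply: hpoint_z1_inj.
Qed.

End GroupOfDesign.
End CoordinateGroups.

(** * Designs from triples *)

Section UnionCardinality.
Variable T : Type.
Implicit Types (A : set T).

(** The numbering of [A2] is shifted by [m] and appended to that of [A1]. *)
Lemma card_eq_setU A1 A2 m k : A1 `&` A2 = set0 -> A1 #= `I_m -> A2 #= `I_k ->
  A1 `|` A2 #= `I_(m + k).
Proof.
move=> A12 /card_set_bijP[f [fA finj fsurj]] /card_set_bijP[g [gA ginj gsurj]].
have nA1 x : A2 x -> (x \in A1) = false.
  move=> A2x; apply/negP; rewrite inE => A1x.
  by have : (A1 `&` A2) x by []; rewrite A12.
apply/card_set_bijP; exists (fun x => if x \in A1 then f x else (m + g x)%N).
split=> [x [A1x|A2x]|x y|i].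
- by rewrite mem_set//; apply: ltn_addr; apply: fA.
- by rewrite nA1//= ltn_add2l; apply: gA.
- rewrite !inE => -[A1x|A2x] [A1y|A2y]; rewrite ?(mem_set A1x) ?(mem_set A1y) ?nA1//.
  + by apply: finj; rewrite inE.
  + by move=> e; have /= := fA _ A1x; rewrite e ltnNge leq_addr.
  + by move=> e; have /= := fA _ A1y; rewrite -e ltnNge leq_addr.
  + by move=> /addnI; apply: ginj; rewrite inE.
- move=> /= imk; have [im|mi] := ltnP i m.
    by have [x A1x <-] := fsurj _ im; exists x; [left|rewrite mem_set].
  have [|x A2x gx] := gsurj (i - m)%N; first by rewrite /= ltn_subLR.
  by exists x; [right|rewrite nA1// gx subnKC].
Qed.

Lemma card_set3 (x y z : T) : x <> y -> x <> z -> y <> z -> [set x; y; z] #= `I_3.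
Proof.
move=> xy xz yz; apply: (@card_eq_setU _ _ 2 1); last exact: card_set1.
  by rewrite -subset0 => t [[]] -> /=.
apply: (@card_eq_setU _ _ 1 1); [|exact: card_set1..].
by rewrite -subset0 => t [] -> /=.
Qed.

End UnionCardinality.

(** * Designs from a ternary relation *)

Section TransversalTriples.
Variable T : Type.
Implicit Types (x y : T) (Q X : set T) (R : T -> T -> T -> Prop).

(** A general relation, with [collinear_triples] as an instance, allows the three sets to be
    permuted together with the arguments of [R]. *)
Definition transversal_triples Q1 Q2 Q3 R : set (set T) :=
  [set b | exists p1 p2 p3,
    [/\ Q1 p1, Q2 p2, Q3 p3, R p1 p2 p3 & b = [set p1; p2; p3]]].

Lemma transversal_triplesCA Q1 Q2 Q3 R : transversal_triples Q1 Q2 Q3 R =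
  transversal_triples Q2 Q1 Q3 (fun p2 p1 p3 => R p1 p2 p3).
Proof.
by apply/seteqP; split=> _ [p [q [r [Qp Qq Qr Rpqr ->]]]]; exists q, p, r;
  split=> //; apply: set3CA.
Qed.

Lemma transversal_triplesAC Q1 Q2 Q3 R : transversal_triples Q1 Q2 Q3 R =
  transversal_triples Q1 Q3 Q2 (fun p1 p3 p2 => R p1 p2 p3).
Proof.
by apply/seteqP; split=> _ [p [q [r [Qp Qq Qr Rpqr ->]]]]; exists p, r, q;
  split=> //; apply: set3AC.
Qed.

(** Both alternatives of the design axiom, with parts and blocks in the roles of [E] and [E'] in
    either order. *)
Definition unique_common (E E' : set (set T)) x y : Prop :=
  (exists! b, [/\ E b, b x & b y]) /\ ~ (exists X, [/\ E' X, X x & X y]).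

Lemma unique_commonC E E' x y : unique_common E E' x y -> unique_common E E' y x.
Proof.
move=> [[b [[Eb bx bY] uniqb]] nX]; split; last by move=> [X [? ? ?]]; apply: nX; exists X.
by exists b; split=> // b' [? ? ?]; apply: uniqb.
Qed.

(** A transversal triple has only one point in [Q1], so it cannot contain both [x] and [y]. *)
Lemma unique_common_part Q1 Q2 Q3 R x y :
    Q1 `&` Q2 = set0 -> Q1 `&` Q3 = set0 -> Q1 x -> Q1 y -> x <> y ->
  unique_common [set Q1; Q2; Q3] (transversal_triples Q1 Q2 Q3 R) x y.
Proof.
move=> Q12 Q13 Q1x Q1y xy.
have nQ2 p : Q1 p -> Q2 p -> False by move=> ? ?; rewrite -[False]/(set0 p) -Q12.
have nQ3 p : Q1 p -> Q3 p -> False by move=> ? ?; rewrite -[False]/(set0 p) -Q13.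
split.
  exists Q1; split=> [|X [[[]|] ->]//]; first by split=> //; left; left.
    by move=> /(nQ2 _ Q1x).
  by move=> /(nQ3 _ Q1x).
move=> [_ [[p [q [r [_ Qq Qr _ ->]]]]]].
have onlyp t : Q1 t -> [set p; q; r] t -> t = p.
  by move=> Q1t [[->//|tq]|tr]; [case: (nQ2 t)|case: (nQ3 t)]; rewrite // ?tq ?tr.
by move=> /(onlyp _ Q1x) xp /(onlyp _ Q1y) yp; rewrite xp yp in xy.
Qed.

Lemma unique_common_block Q1 Q2 Q3 R x y :
    Q1 `&` Q2 = set0 -> Q1 `&` Q3 = set0 -> Q2 `&` Q3 = set0 ->
    (forall p q, Q1 p -> Q2 q -> exists! r, Q3 r /\ R p q r) -> Q1 x -> Q2 y ->
  unique_common (transversal_triples Q1 Q2 Q3 R) [set Q1; Q2; Q3] x y.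
Proof.
move=> Q12 Q13 Q23 third Q1x Q2y.
have n12 p : Q1 p -> Q2 p -> False by move=> ? ?; rewrite -[False]/(set0 p) -Q12.
have n13 p : Q1 p -> Q3 p -> False by move=> ? ?; rewrite -[False]/(set0 p) -Q13.
have n23 p : Q2 p -> Q3 p -> False by move=> ? ?; rewrite -[False]/(set0 p) -Q23.
split; last first.
  by move=> [X [[[]|] -> Xx Xy]]; [exact: (n12 y)|exact: (n12 x)|exact: (n13 x)].
have [r [[Q3r Rr] uniqr]] := third _ _ Q1x Q2y.
exists [set x; y; r]; split.
  by split; [exists x, y, r|left; left|left; right].
move=> _ [[p [q [r' [Qp Qq Qr' Rr' ->]]]]] xb yb.
have xp : x = p.
  by case: xb => [[//|e]|e]; [case: (n12 x)|case: (n13 x)]; rewrite // e.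
have yq : y = q.
  by case: yb => [[e|//]|e]; [case: (n12 y)|case: (n23 y)]; rewrite // e.
by rewrite -xp -yq in Rr' *; rewrite (uniqr r').
Qed.

Lemma transversal_design_triples n Q1 Q2 Q3 R : (3 <= n)%N ->
    Q1 `&` Q2 = set0 -> Q1 `&` Q3 = set0 -> Q2 `&` Q3 = set0 ->
    Q1 #= `I_n -> Q2 #= `I_n -> Q3 #= `I_n ->
    (forall p q, Q1 p -> Q2 q -> exists! r, Q3 r /\ R p q r) ->
    (forall p r, Q1 p -> Q3 r -> exists! q, Q2 q /\ R p q r) ->
    (forall q r, Q2 q -> Q3 r -> exists! p, Q1 p /\ R p q r) ->
  transversal_design 3 n (Q1 `|` Q2 `|` Q3) [set Q1; Q2; Q3]
    (transversal_triples Q1 Q2 Q3 R).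
Proof.
move=> n3 Q12 Q13 Q23 c1 c2 c3 t3 t2 t1.
have n12 p : Q1 p -> Q2 p -> False by move=> ? ?; rewrite -[False]/(set0 p) -Q12.
have n13 p : Q1 p -> Q3 p -> False by move=> ? ?; rewrite -[False]/(set0 p) -Q13.
have n23 p : Q2 p -> Q3 p -> False by move=> ? ?; rewrite -[False]/(set0 p) -Q23.
have ne Q : Q #= `I_n -> Q !=set0.
  move=> cQ; apply/set0P/eqP => Q0.
  move: cQ; rewrite Q0 card_eq_sym card_eq0 => /eqP In0.
  have : `I_n 0%N by apply: leq_trans n3.
  by rewrite In0.
split=> //.
- rewrite !mulSn mul0n addn0 addnA; apply: card_eq_setU => //.
    by rewrite setIUl Q13 Q23 setU0.
  exact: card_eq_setU.
- split.
  + split.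
    * by rewrite /cover !bigcup_setU !bigcup_set1.
    * by move=> X Y [[]|] -> [[]|] -> [p []] //= a1 a2; exfalso; eauto.
    * by move=> X [[]|] ->; apply: ne.
  + have [p1 Qp1] := ne _ c1; have [p2 Qp2] := ne _ c2.
    apply: card_set3 => e.
    * by apply: (n12 p1); rewrite -?e.
    * by apply: (n13 p1); rewrite -?e.
    * by apply: (n23 p2); rewrite -?e.
  + by move=> X [[]|] ->.
- move=> _ [p [q [r [Qp Qq Qr Rpqr ->]]]]; split.
    by move=> t [[]|] ->; [left; left|left; right|right].
  by apply: card_set3 => e; [apply: (n12 p)|apply: (n13 p)|apply: (n23 q)]; rewrite // e.
have E132 : [set Q1; Q2; Q3] = [set Q1; Q3; Q2] by apply: set3AC.
have E213 : [set Q1; Q2; Q3] = [set Q2; Q1; Q3] by apply: set3CA.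
have E231 : [set Q1; Q2; Q3] = [set Q2; Q3; Q1] by rewrite set3CA set3AC.
have E312 : [set Q1; Q2; Q3] = [set Q3; Q1; Q2] by rewrite set3AC set3CA.
have block12 x y : Q1 x -> Q2 y -> unique_common
    (transversal_triples Q1 Q2 Q3 R) [set Q1; Q2; Q3] x y.
  exact: unique_common_block.
have block13 x y : Q1 x -> Q3 y -> unique_common
    (transversal_triples Q1 Q2 Q3 R) [set Q1; Q2; Q3] x y.
  rewrite transversal_triplesAC E132; apply: unique_common_block => //.
  by rewrite setIC.
have block23 x y : Q2 x -> Q3 y -> unique_common
    (transversal_triples Q1 Q2 Q3 R) [set Q1; Q2; Q3] x y.
  rewrite transversal_triplesCA transversal_triplesAC E231.
  by apply: unique_common_block => //; rewrite setIC.
move=> x y Vx Vy xy.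
(* Of the nine cases, the three with both points in one set use [unique_common_part]; the six others
   are the block statements above, up to exchanging the points. *)
case: Vx => [[]|] Qx; case: Vy => [[]|] Qy.
- by left; apply: unique_common_part.
- by right; apply: block12.
- by right; apply: block13.
- by right; apply/unique_commonC/block12.
- left; rewrite E213 transversal_triplesCA.
  by apply: unique_common_part; rewrite // setIC.
- by right; apply: block23.
- by right; apply/unique_commonC/block13.
- by right; apply/unique_commonC/block23.
- left; rewrite E312 transversal_triplesAC transversal_triplesCA.
  by apply: unique_common_part; rewrite // setIC.
Qed.

End TransversalTriples.

(** * The design of a group *)

Section DesignOfGroup.
Variable D : unitRingType.
Hypothesis skewD : forall x : D, x != 0 -> x \is a GRing.unit.
Variables (d n : nat) (U : 'M[D]_d.+1) (G : set 'cV[D]_d.-1).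
Hypotheses (d_gt0 : (0 < d)%N) (n_ge3 : (3 <= n)%N).
Hypotheses (bU : columns_basis U) (sG : additive_subgroup n G).
Implicit Types (p : proj_point D d).

Let V := part1 U G `|` part2 U G `|` part3 U G.
Let P := [set part1 U G; part2 U G; part3 U G].
Let B := collinear_triples (part1 U G) (part2 U G) (part3 U G).

Lemma part1_loci p : part1 U G p -> [/\ xd_eq0 U p, ~ xd_eq_xd1 U p & ~ xd1_eq0 U p].
Proof.
move=> [x _ <-]; have x0 := xyz_z1_neq0 d_gt0 x 0; split.
- exact: hpoint_xd_eq0.
- by rewrite xd_eq_xd1P// => /esym/eqP; rewrite oner_eq0.
- by rewrite xd1_eq0P// => /eqP; rewrite oner_eq0.
Qed.

Lemma part2_loci p : part2 U G p -> [/\ ~ xd_eq0 U p, xd_eq_xd1 U p & ~ xd1_eq0 U p].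
Proof.
move=> [x _ <-]; have x0 := xyz_z1_neq0 d_gt0 x 1; split.
- by rewrite xd_eq0P// => /eqP; rewrite oner_eq0.
- exact: hpoint_xd_eq_xd1.
- by rewrite xd1_eq0P// => /eqP; rewrite oner_eq0.
Qed.

Lemma part3_loci p : part3 U G p -> [/\ ~ xd_eq0 U p, ~ xd_eq_xd1 U p & xd1_eq0 U p].
Proof.
move=> [x _ <-]; have x0 := xyz_y1_neq0 d_gt0 (- x) 0; split.
- by rewrite xd_eq0P// => /eqP; rewrite oner_eq0.
- by rewrite xd_eq_xd1P// => /eqP; rewrite oner_eq0.
- exact: hpoint_xd1_eq0.
Qed.

Lemma xd_eq0_union_parts : xd_eq0 U `&` V = part1 U G.
Proof.
apply/seteqP; split=> [p [Hp [[//|]|]]|p Q1p].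
- by move=> /part2_loci[].
- by move=> /part3_loci[].
- by split; [have [] := part1_loci Q1p|left; left].
Qed.

Lemma xd_eq_xd1_union_parts : xd_eq_xd1 U `&` V = part2 U G.
Proof.
apply/seteqP; split=> [p [Hp [[|//]|]]|p Q2p].
- by move=> /part1_loci[].
- by move=> /part3_loci[].
- by split; [have [] := part2_loci Q2p|left; right].
Qed.

Lemma xd1_eq0_union_parts : xd1_eq0 U `&` V = part3 U G.
Proof.
apply/seteqP; split=> [p [Hp [[|]|//]]|p Q3p].
- by move=> /part1_loci[].
- by move=> /part2_loci[].
- by split; [have [] := part3_loci Q3p|right].
Qed.

Lemma coordinate_group_union_parts :
  coordinate_group n V (xd_eq0 U) (xd_eq_xd1 U) (xd1_eq0 U) U G.
Proof.
split=> //; split; first exact: xd_eq0_union_parts.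
  exact: xd_eq_xd1_union_parts.
exact: xd1_eq0_union_parts.
Qed.

Lemma transversal_design_parts : transversal_design 3 n V P B.
Proof.
have [_ cG] := sG.
have GB x y := additive_subgroupB (x := x) (y := y) sG.
have GD x y := additive_subgroupD (x := x) (y := y) sG.
apply: transversal_design_triples => //.
- by rewrite -subset0 => p [/part1_loci[Hp _ _] /part2_loci[]].
- by rewrite -subset0 => p [/part1_loci[Hp _ _] /part3_loci[]].
- by rewrite -subset0 => p [/part2_loci[_ Hp _] /part3_loci[]].
- apply: card_eq_trans cG; apply: inj_card_eq => x y _ _.
  exact: hpoint_z1_inj.
- apply: card_eq_trans cG; apply: inj_card_eq => x y _ _.
  exact: hpoint_z1_inj.
- apply: card_eq_trans cG; apply: inj_card_eq => x y _ _.
  by move=> /(hpoint_y1_inj d_gt0 bU)/oppr_inj.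
(* Collinearity requires the coordinate [y - x], written as an opposite because [part3] uses
   [- g]. *)
- move=> _ _ [x Gx <-] [y Gy <-]; exists (hpoint U (- (x - y)) 1 0); split.
    split; first by exists (x - y) => //; apply: GB.
    by rewrite collinear_hpointP// opprB addrC subrK.
  move=> _ [[z Gz <-]]; rewrite collinear_hpointP// => ->.
  by rewrite opprB addrC addKr.
- move=> _ _ [x Gx <-] [z Gz <-]; exists (hpoint U (x - z) 1 1); split.
    split; first by exists (x - z) => //; apply: GB.
    by rewrite collinear_hpointP.
  by move=> _ [[y Gy <-]]; rewrite collinear_hpointP// => ->.
- move=> _ _ [y Gy <-] [z Gz <-]; exists (hpoint U (y + z) 0 1); split.
    split; first by exists (y + z) => //; apply: GD.
    by rewrite collinear_hpointP// addrK.
  by move=> _ [[x Gx <-]]; rewrite collinear_hpointP// => ->; rewrite subrK.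
Qed.

(** A line is chosen for each block. It lies in none of the hyperplanes because the block has a
    point off each of them, and the relation [y = x + z] shows that different blocks have different
    lines. *)
Lemma lies_on_parts : lies_on V P B (xd_eq0 U) (xd_eq_xd1 U) (xd1_eq0 U).
Proof.
have G0 : G 0 by apply: additive_subgroup0 sG.
have Q1 : part1 U G (hpoint U 0 0 1) by exists 0.
have Q2 : part2 U G (hpoint U 0 1 1) by exists 0.
split.
- by move=> p [[/part1_loci[[]]|/part2_loci[_ []]]|/part3_loci[_ _ []]].
- split.
  + have -> : xd_eq0 U = locus U (fun c => 1 * c (inord d.-1) 0 + 0 * c ord_max 0 = 0).
      by congr locus; apply/funext => c; rewrite mul1r mul0r addr0.
    apply: columns_basis_locus_hyperplane => // -[/eqP].
    by rewrite oner_eq0.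
  + have -> : xd_eq_xd1 U =
        locus U (fun c => 1 * c (inord d.-1) 0 + -1 * c ord_max 0 = 0).
      congr locus; apply/funext => c; rewrite mul1r mulN1r; apply/propext.
      by split=> [->|/eqP]; rewrite ?subrr// subr_eq0 => /eqP.
    apply: columns_basis_locus_hyperplane => // -[/eqP].
    by rewrite oner_eq0.
  + have -> : xd1_eq0 U = locus U (fun c => 0 * c (inord d.-1) 0 + 1 * c ord_max 0 = 0).
      by congr locus; apply/funext => c; rewrite mul1r mul0r add0r.
    apply: columns_basis_locus_hyperplane => // -[_ /eqP].
    by rewrite oner_eq0.
- have [h11 h12 h13] := part1_loci Q1; have [h21 h22 h23] := part2_loci Q2.
  by split=> e; [apply: h12|apply: h13|apply: h23]; rewrite -e.
- by rewrite !(setIC V) xd_eq0_union_parts xd_eq_xd1_union_parts xd1_eq0_union_parts.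
- have chosen (b : set (proj_point D d)) : exists l, B b -> line l /\ b `<=` l.
    have [[p [q [r [_ _ _ [l [lineL lp lq lr]] bE]]]]|nB] := pselect (B b).
      by rewrite bE; exists l => _; split=> // t [[]|] ->.
    (* A dummy value for sets that are not blocks. *)
    by exists set0.
  have [ell ellP] := choice chosen; exists ell; split=> // [b b' Bb Bb'|b Bb]; last first.
    have [_] := ellP _ Bb.
    case: Bb => [p [q [r [/part1_loci[_ p2 p3] /part2_loci[q1 _ _] _ _ bE]]]] bl.
    rewrite {1}bE in bl; split=> lH.
    + by apply/q1/lH/bl; left; right.
    + by apply/p2/lH/bl; left; left.
    + by apply/p3/lH/bl; left; left.
  have [lineL bl] := ellP _ Bb; have [_ bl'] := ellP _ Bb'.
  move=> ellE.
  have [p [q [r [[x _ xE] [y _ yE] [z _ zE] _ bE]]]] := Bb.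
  have [p' [q' [r' [[x' _ xE'] [y' _ yE'] [z' _ zE'] _ bE']]]] := Bb'.
  (* Two blocks with the same line have all their points collinear. Exchanging one point of [b] for
     its counterpart in [b'] keeps [y = x + z], and two of the coordinates determine the third, so
     the points agree. *)
  have colE s t u : (b `|` b') s -> (b `|` b') t -> (b `|` b') u -> collinear s t u.
    move=> bs bt bu; exists (ell b).
    have bbl v : (b `|` b') v -> ell b v by move=> [/bl|/bl']; rewrite -?ellE.
    by split=> //; apply: bbl.
  have [bp bq br] : [/\ b p, b q & b r] by rewrite bE; split; [left; left|left; right|right].
  have [bp' bq' br'] : [/\ b' p', b' q' & b' r'].
    by rewrite bE'; split; [left; left|left; right|right].
  have := colE p q r (or_introl bp) (or_introl bq) (or_introl br).
  have := colE p' q r (or_intror bp') (or_introl bq) (or_introl br).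
  have := colE p q' r (or_introl bp) (or_intror bq') (or_introl br).
  have := colE p q r' (or_introl bp) (or_introl bq) (or_intror br').
  rewrite bE bE' -xE -yE -zE -xE' -yE' -zE' !collinear_hpointP//.
  by move=> yz' -> yx' yE0; move: yz' yx'; rewrite yE0 => /addrI <- /addIr <-.
Qed.

End DesignOfGroup.

Theorem proposition11 (D : unitRingType) (skewD : forall x : D, x != 0 -> x \is a GRing.unit)
    (d : nat) (hd : (2 <= d)%N) :
  (forall (n : nat) (V : set (proj_point D d)) (P B : set (set (proj_point D d)))
      (H1 H2 H3 : set (proj_point D d)),
    transversal_design 3 n V P B ->
    lies_on V P B H1 H2 H3 ->
    flat (d - 2) (H1 `&` H2 `&` H3) ->
    (* the choices can be made *)
    [/\ forall p1 p2, (H1 `&` V) p1 -> (H2 `&` V) p2 ->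
          (exists! p3, third_point V B H3 p1 p2 p3) /\
          (forall p3, third_point V B H3 p1 p2 p3 ->
             exists U, adapted_basis H1 H2 H3 p1 p2 p3 U),
    (* equations of the hyperplanes, and the group *)
        forall p1 p2 p3 U, admissible_choice V B H1 H2 H3 p1 p2 p3 U ->
          [/\ H1 = xd_eq0 U, H2 = xd_eq_xd1 U & H3 = xd1_eq0 U] /\
          (exists G, coordinate_group n V H1 H2 H3 U G),
    (* the group depends only on the coordinates *)
        forall p1 p2 p3 p1' p2' p3' U G G',
          admissible_choice V B H1 H2 H3 p1 p2 p3 U ->
          admissible_choice V B H1 H2 H3 p1' p2' p3' U ->
          coordinate_group n V H1 H2 H3 U G ->
          coordinate_group n V H1 H2 H3 U G' ->
          G = G'
    (* two choices give equivalent groups *)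
      & forall p1 p2 p3 U1 G1 p1' p2' p3' U2 G2,
          admissible_choice V B H1 H2 H3 p1 p2 p3 U1 ->
          admissible_choice V B H1 H2 H3 p1' p2' p3' U2 ->
          coordinate_group n V H1 H2 H3 U1 G1 ->
          coordinate_group n V H1 H2 H3 U2 G2 ->
          exists (a : D) (T : 'M[D]_d.-1),
            [/\ a != 0, general_linear T
              & G1 = [set rscale (T *m g) a | g in G2]]])
  /\
  (forall (n : nat) (U : 'M[D]_d.+1) (G : set 'cV[D]_d.-1),
    (3 <= n)%N -> columns_basis U -> additive_subgroup n G ->
    let V := part1 U G `|` part2 U G `|` part3 U G in
    let P := [set part1 U G; part2 U G; part3 U G] in
    let B := collinear_triples (part1 U G) (part2 U G) (part3 U G) in
    [/\ transversal_design 3 n V P B,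
        lies_on V P B (xd_eq0 U) (xd_eq_xd1 U) (xd1_eq0 U)
      & coordinate_group n V (xd_eq0 U) (xd_eq_xd1 U) (xd1_eq0 U) U G]).
Proof.
have d_gt0 : (0 < d)%N by apply: leq_trans hd.
split=> [n V P B H1 H2 H3 td lies HF|n U G n3 bU sG]; last first.
  split; first exact: transversal_design_parts.
    exact: lies_on_parts bU sG.
  exact: coordinate_group_union_parts.
have [V_proj [h1 h2 h3] _ PE [ell [ellP _ _]]] := lies.
have PE132 : P = [set V `&` H1; V `&` H3; V `&` H2] by rewrite PE set3AC.
have PE231 : P = [set V `&` H2; V `&` H3; V `&` H1] by rewrite PE set3CA set3AC.
have n12 p : V p -> H1 p -> H2 p -> False.
  by move=> Vp H1p H2p; apply: (td_parts_disjoint td PE (p := p)).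
have n13 p : V p -> H1 p -> H3 p -> False.
  by move=> Vp H1p H3p; apply: (td_parts_disjoint td PE132 (p := p)).
have n23 p : V p -> H2 p -> H3 p -> False.
  by move=> Vp H2p H3p; apply: (td_parts_disjoint td PE231 (p := p)).
have block_collinear b p1 p2 p3 : B b -> b p1 -> b p2 -> b p3 -> collinear p1 p2 p3.
  by move=> /ellP[lineL bl] ? ? ?; exists (ell b); split=> //; apply: bl.
have equations p1 p2 p3 U : admissible_choice V B H1 H2 H3 p1 p2 p3 U ->
    [/\ H1 = xd_eq0 U, H2 = xd_eq_xd1 U & H3 = xd1_eq0 U].
  move=> [[H1p _] [H2p _] [[H3p _] _] adp].
  exact: (adapted_equations skewD d_gt0 h1 h2 h3 H1p H2p H3p adp).
split.
- move=> p1 p2 [H1p Vp1] [H2p Vp2]; split.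
    have := td_third td PE (conj Vp1 H1p) (conj Vp2 H2p).
    by rewrite /third_point setIC.
  move=> p3 [[H3p Vp3] [b [Bb bp1 bp2 bp3]]].
  apply: (adapted_basis_exists skewD d_gt0 _ h1 h2 h3 HF).
  (* Subtraction is truncated; [2 <= d] gives [(d - 2).+1 = d.-1], the number of basis vectors of
     the axis. *)
  + by case: (d) hd => [|[|k]]//; rewrite subn2.
  + exact: (block_collinear b).
  + by split; apply: V_proj.
  (* Points of the design avoid the other two hyperplanes, as the parts are disjoint. *)
  + by split=> // ?; [apply: (n12 p1)|apply: (n13 p1)].
  + by split=> // ?; [apply: (n12 p2)|apply: (n23 p2)].
  + by split=> // ?; [apply: (n13 p3)|apply: (n23 p3)].
- move=> p1 p2 p3 U adm; have [e1 e2 e3] := equations _ _ _ _ adm.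
  split=> //; case: adm => [[_ Vp1] [_ Vp2] [[_ Vp3] _] [bU _ p1E p2E p3E]].
  rewrite e1 e2 e3; apply: (coordinate_group_exists skewD d_gt0 td bU V_proj) => //.
  + by rewrite -e1 -e2 -e3.
  + by rewrite -p1E.
  + by rewrite -p2E.
  + by rewrite -p3E.
- move=> p1 p2 p3 p1' p2' p3' U G G' [_ _ _ [bU _ _ _ _]] _.
  exact: coordinate_group_unique.
- move=> p1 p2 p3 U1 G1 p1' p2' p3' U2 G2 adm1 adm2.
  have [e1 _ e3] := equations _ _ _ _ adm1.
  have [e1' _ e3'] := equations _ _ _ _ adm2.
  case: adm1 adm2 => [_ _ _ [bU1 _ _ _ _]] [_ _ _ [bU2 _ _ _ _]].
  exact: coordinate_groups_equivalent.
Qed.
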